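(* Let $(\pi,F,H,K)$ be a group chunk over $C$ on a hyperdefinable set $P$. Then there exist a $C$-hyperdefinable group $G = (Y/F', \cdot_G)$ and a $C$-type-definable partial function $f: \pi \to G$ (i.e. a partial function from $P$ to $G$) defined and injective on $\pi$, so that for any $(a,b) \models \pi^{\otimes 2}|_{C}$ we have $f(F(a,b)) = f(a) \cdot_{G} f(b)$, and the global partial type $f_{*} \pi$ concentrates on $G$ and is left-$G$-invariant.
   Context: $\mathbb{M}$ is a monster model of a complete theory $T$. Hyperdefinability. A hyperdefinable set (over $C$) is $P=X/E$ with $X$ a non-empty type-definable set and $E$ a type-definable equivalence relation (over $C$); its elements are hyperimaginaries; $\mathbb{M}^{\mathrm{heq}}$ is $\mathbb{M}$ together with all hyperimaginaries. Products of hyperdefinable sets are again hyperdefinable in the natural way. A partial type on $P$ over a (possibly large) set $\{b_i/F_i\}_i$ of hyperimaginaries is a partial type $\pi^*(x,(b_i)_i)$, where $\pi^*(x,(y_i)_i)$ is a partial type over $\emptyset$ that is $E$-invariant in $x$ and $F_i$-invariant in each $y_i$ and implies membership in $X$ and in the sorts of the $b_i$; $a/E$ realizes it if $a$ does. Type-definable subsets of, relations on and (partial) functions between hyperdefinable sets are those given (via their graphs) by small partial types; $\Gamma_f$ denotes the graph of $f$. $\pi$ is closed under implication if it contains every small partial type on $P$ (over hyperimaginaries) which it implies. $\pi$ is type-definable over $A\subseteq\mathbb{M}^{\mathrm{heq}}$ if for every hyperdefinable sort $Q$ and small partial type $\gamma(x,y)$ on $P\times Q$ over $\emptyset$ the set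 $\{b\in Q:\pi(x)\vdash\gamma(x,b)\}$ is $A$-type-definable; this set is denoted $(d_\pi x)\gamma(x,y)$. $\pi|_C$ is the union of all $\gamma(x,m)$ with $m$ in $C$, $\gamma(x,y)$ a small partial type over $\emptyset$, and $\pi\vdash\gamma(x,m)$. A type-definable partial function $f:P\to Q$ is defined on $\pi$ if $\pi(x)\vdash\exists y\,\Gamma_f(x,y)$; then $f_*\pi$ is the union of all small partial types $\gamma(y)$ on $Q$ with $\pi(x)\vdash\exists u(\Gamma_f(x,u)\wedge\gamma(u))$. ''Injective on $\pi$'' means injective on the realizations of $\pi|_C$. For $A$-type-definable $\pi,\rho$ on $P,Q$, $\pi\otimes\rho$ is the partial type on $P\times Q$ given by $(d_{\pi\otimes\rho}xy)\gamma(x,y;z)=(d_\pi x)((d_\rho y)\gamma(x,y,z))$; thus for $B\supseteq A$, $(a,b)\models(\pi\otimes\rho)|_B$ iff $a\models\pi|_B$ and $b\models\rho|_{B,a}$. $\pi^{\otimes n}$ is the $n$-fold product. A hyperdefinable group over $C$ is a hyperdefinable set over $C$ with a $C$-type-definable group operation. For $\pi$ a partial type on $G$ and $g\in G(\mathbb{M})$, $g\cdot\pi:=(t_g)_*\pi$ where $t_g(h)=g\cdot h$; $\pi$ is left-$G$-invariant if $g\cdot\pi=\pi$ for all $g\in G(\mathbb{M})$. Group chunk. Let $P=X/E$ with $X,E$ type-definable over $C$. A group chunk over a small set $C\subseteq\mathbb{M}^{\mathrm{heq}}$ on $P$ is a $C$-type-definable partial type $\pi(x)$ on $P$ closed under implication,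 together with $C$-type-definable partial functions $F,H:P^2\to P$ defined on $\pi^{\otimes2}$ and $K:P^2\to P$, such that: (1) for all $a\models\pi|_C$, $(F_a)_*\pi=\pi$, where $F_a(x):=F(a,x)$; (2) if $(a,b)\models\pi^{\otimes2}|_C$, then $H(a,F(a,b))=b$ and $K(b,F(a,b))=a$ (in particular the partial function $K$ is defined there); (3) if $(a,b,c)\models\pi^{\otimes3}|_C$, then $F(a,F(b,c))=F(F(a,b),c)$. *)

(* Defs.v *)
From mathcomp Require Import all_boot.
From mathcomp Require Import boolp classical_sets functions cardinality.

Set Implicit Arguments.
Unset Strict Implicit.
Unset Printing Implicit Defensive.

Local Open Scope classical_set_scope.
Local Open Scope card_scope.

Record language := Language {
  fun_sym : Type;
  fun_arity : fun_sym -> nat;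
  rel_sym : Type;
  rel_arity : rel_sym -> nat }.

Section Syntax.
Variable L : language.

Inductive term (V : Type) : Type :=
| Var of V
| App (f : fun_sym L) of ('I_(fun_arity f) -> term V).

(* [formula V]: formulas whose free variables are taken in the type [V].  The
   quantifier binds the variable [None] of its body. *)
Inductive formula (V : Type) : Type :=
| Bot
| Equal of term V & term V
| Rel (r : rel_sym L) of ('I_(rel_arity r) -> term V)
| Imp of formula V & formula V
| All of formula (option V).

Record structure := Structure {
  carrier :> Type;
  carrier_inhabited : inhabited carrier;
  fun_interp : forall f : fun_sym L, ('I_(fun_arity f) -> carrier) -> carrier;
  rel_interp : forall r : rel_sym L, ('I_(rel_arity r) -> carrier) -> Prop }.

Fixpoint eval (M : structure) (V : Type) (e : V -> M) (t : term V) : M :=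
  match t with
  | Var v => e v
  | App f ts => @fun_interp M f (fun i => eval e (ts i))
  end.

Definition extend (M V : Type) (e : V -> M) (m : M) (o : option V) : M :=
  if o is Some v then e v else m.

Fixpoint sat (M : structure) (V : Type) (e : V -> M) (phi : formula V) : Prop :=
  match phi with
  | Bot => False
  | Equal t u => eval e t = eval e u
  | Rel r ts => @rel_interp M r (fun i => eval e (ts i))
  | Imp phi1 phi2 => sat e phi1 -> sat e phi2
  | All phi1 => forall m : M, sat (extend e m) phi1
  end.

Definition sentence := formula Empty_set.

Definition true_in (M : structure) (s : sentence) : Prop :=
  sat (fun v : Empty_set => match v return M with end) s.

Definition models (M : structure) (T : set sentence) : Prop :=
  forall s, T s -> true_in M s.

Definition consequence (T : set sentence) (s : sentence) : Prop :=
  forall N : structure, models N T -> true_in N s.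

Definition complete_theory (T : set sentence) : Prop :=
  (exists N : structure, models N T) /\
  forall s, consequence T s \/ consequence T (Imp s (Bot _)).

Definition automorphism (M : structure) (s : M -> M) : Prop :=
  [/\ bijective s,
      forall (f : fun_sym L) (a : 'I_(fun_arity f) -> M),
        s (fun_interp a) = fun_interp (s \o a) &
      forall (r : rel_sym L) (a : 'I_(rel_arity r) -> M),
        rel_interp a <-> rel_interp (s \o a)].

End Syntax.

Arguments Bot {L V}.

(* Cardinals are represented by types; "small" means of cardinality [< kappa]. *)
Definition small (kappa : Type) (T : Type) (A : set T) : Prop :=
  (A #<= [set: kappa]) /\ ~ ([set: kappa] #<= A).

Definition regular_cardinal (kappa : Type) : Prop :=
  forall (I : Type) (A : I -> Type), small kappa [set: I] ->
    (forall i, small kappa [set: A i]) -> small kappa [set: {i : I & A i}].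

Definition join (M I J : Type) (a : I -> M) (b : J -> M) (k : I + J) : M :=
  match k with inl i => a i | inr j => b j end.

Section Types.
Variables (L : language) (M : structure L).

Definition zeroset (I : Type) (Phi : set (formula L I)) : set (I -> M) :=
  [set a | forall phi, Phi phi -> sat a phi].

(* Formulas with parameters in [M]: the parameters are the [inr] variables. *)
Definition pformula (I : Type) := formula L (I + M).

Definition psat (I : Type) (a : I -> M) (phi : pformula I) : Prop :=
  sat (join a id) phi.

Definition realizations (I : Type) (Gamma : set (pformula I)) : set (I -> M) :=
  [set a | forall phi, Gamma phi -> psat a phi].

(* [Pi |- phi] in the elementary diagram of [M]: by compactness, a finite part
   of [Pi] implies [phi] in [M]. *)
Definition entails (I : Type) (Pi : set (pformula I)) (phi : pformula I) : Prop :=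
  exists Pi0 : set (pformula I),
    [/\ finite_set Pi0, Pi0 `<=` Pi & realizations Pi0 `<=` [set a | psat a phi]].

Definition finitely_satisfiable (I : Type) (Pi : set (pformula I)) : Prop :=
  forall Pi0, finite_set Pi0 -> Pi0 `<=` Pi -> realizations Pi0 !=set0.

(* Saturation for partial types in small tuples of variables.  A formula has
   finitely many parameters, so a small set of formulas has small parameter set. *)
Definition saturated (kappa : Type) : Prop :=
  forall (I : Type) (Gamma : set (pformula I)),
    small kappa [set: I] -> small kappa Gamma -> finitely_satisfiable Gamma ->
    realizations Gamma !=set0.

Definition same_type (I : Type) (a b : I -> M) : Prop :=
  forall phi : formula L I, sat a phi <-> sat b phi.

Definition strongly_homogeneous (kappa : Type) : Prop :=
  forall (I : Type) (a b : I -> M), small kappa [set: I] -> same_type a b ->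
    exists s : M -> M, automorphism s /\ s \o a = b.

Record monster (T : set (sentence L)) (kappa : Type) : Prop := Monster {
  monster_models : models M T;
  monster_uncountable : small kappa [set: nat];
  monster_regular : regular_cardinal kappa;
  monster_funs : small kappa [set: fun_sym L];
  monster_rels : small kappa [set: rel_sym L];
  monster_saturated : saturated kappa;
  monster_homogeneous : strongly_homogeneous kappa }.

End Types.

Section Hyperdefinable.
Variables (L : language) (kappa : Type) (M : structure L).

(* The data of a quotient [X / E] of a set [X] of [I]-tuples.  Elements are
   given by representatives and compared with [E]. *)
Record quot := Quot {
  ix : Type;
  dom : set (ix -> M);
  eqv : (ix -> M) -> (ix -> M) -> Prop }.

Arguments eqv : clear implicits.

Definition quot_prod (P Q : quot) : quot :=
  @Quot (ix P + ix Q)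
    [set c : ix P + ix Q -> M | dom (c \o inl) /\ dom (c \o inr)]
    (fun c d => eqv P (c \o inl) (d \o inl) /\ eqv Q (c \o inr) (d \o inr)).

Definition rel_set (I J : Type) (R : (I -> M) -> (J -> M) -> Prop) :
  set (I + J -> M) := [set c : I + J -> M | R (c \o inl) (c \o inr)].

Definition hyperdef (typedef : forall I : Type, set (I -> M) -> Prop)
    (P : quot) : Prop :=
  small kappa [set: ix P] /\ @dom P !=set0 /\
  typedef _ (@dom P) /\ typedef _ (rel_set (eqv P)) /\
  (forall a b, eqv P a b -> dom a /\ dom b) /\
  (forall a, dom a -> eqv P a a) /\
  (forall a b, eqv P a b -> eqv P b a) /\
  (forall a b c, eqv P a b -> eqv P b c -> eqv P a c).

Definition typedef0 (I : Type) (D : set (I -> M)) : Prop :=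
  exists Phi : set (formula L I), D = zeroset Phi.

Record hyperimaginary := Hyperimaginary {
  hi_sort : quot;
  hi_sortP : hyperdef typedef0 hi_sort;
  hi_rep : ix hi_sort -> M;
  hi_repP : dom hi_rep }.

(* A small subset of [M^heq], given as a family; real elements are the
   hyperimaginaries of the sort [M / =]. *)
Record heqset := Heqset {
  hs_ix : Type;
  hs_small : small kappa [set: hs_ix];
  hs_el : hs_ix -> hyperimaginary }.

Definition hs_var (C : heqset) : Type :=
  {s : hs_ix C & ix (hi_sort (@hs_el C s))}.

Definition hs_tuple (C : heqset) : hs_var C -> M :=
  fun v => @hi_rep (hs_el (projT1 v)) (projT2 v).

Definition component (C : heqset) (y : hs_var C -> M) (s : hs_ix C) :
  ix (hi_sort (hs_el s)) -> M := fun i =>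
    y (existT (fun s => ix (hi_sort (@hs_el C s))) s i).

Arguments component {C} y s _.

(* [D] is defined by [Phi(x, c)], where [c] represents the elements of [C] and
   the parameter-free partial type [Phi(x, y)] implies that each [y_s] lies in
   the sort of [c_s] and is invariant under its equivalence relation. *)
Definition typedef (C : heqset) (I : Type) (D : set (I -> M)) : Prop :=
  exists Phi : set (formula L (I + hs_var C)),
    [/\ forall x y, zeroset Phi (join x y) -> forall s, dom (component y s),
        forall x y y', (forall s, eqv _ (component y s) (component y' s)) ->
          zeroset Phi (join x y) -> zeroset Phi (join x y') &
        D = [set x | zeroset Phi (join x (@hs_tuple C))]].

Definition hyperdefinable (C : heqset) (P : quot) : Prop :=
  hyperdef (@typedef C) P.

Definition subset_on (P : quot) (D : set (ix P -> M)) : Prop :=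
  D `<=` @dom P /\ forall a b, eqv P a b -> D a -> D b.

(* [f] is the graph, on representatives, of a [C]-type-definable partial
   function from [P] to [Q]. *)
Definition partial_fun (C : heqset) (P Q : quot)
    (f : (ix P -> M) -> (ix Q -> M) -> Prop) : Prop :=
  [/\ @subset_on (quot_prod P Q) (rel_set f), typedef C (rel_set f) &
      forall a b b', f a b -> f a b' -> eqv Q b b'].

(* [Gamma] is a small partial type on [P]; its parameters are arbitrary elements
   of [M], hence cover all representatives of hyperimaginaries. *)
Definition small_type_on (P : quot) (Gamma : set (pformula M (ix P))) : Prop :=
  small kappa Gamma /\ subset_on (realizations Gamma).

(* [Pi |- D], where the set [D] stands for a small partial type defining it. *)
Definition entails_set (I : Type) (Pi : set (pformula M I)) (D : set (I -> M)) : Prop :=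
  exists Gamma : set (pformula M I),
    [/\ small kappa Gamma, realizations Gamma = D &
        forall phi, Gamma phi -> entails Pi phi].

Definition partial_type_on (P : quot) (Pi : set (pformula M (ix P))) : Prop :=
  entails_set Pi (@dom P) /\
  forall phi, Pi phi ->
    exists Gamma, [/\ small_type_on Gamma, Gamma `<=` Pi & Gamma phi].

Definition closed_under_implication (P : quot) (Pi : set (pformula M (ix P))) :
    Prop :=
  forall Gamma, small_type_on Gamma ->
    (forall phi, Gamma phi -> entails Pi phi) -> Gamma `<=` Pi.

(* The set [(d_Pi x) gamma(x, y)]. *)
Definition dpi (P Q : quot) (Pi : set (pformula M (ix P)))
    (gamma : set (ix P + ix Q -> M)) : set (ix Q -> M) :=
  [set b | dom b /\ entails_set Pi [set a | gamma (join a b)]].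

Definition type_definable (C : heqset) (P : quot) (Pi : set (pformula M (ix P))) :
    Prop :=
  forall (Q : quot) (gamma : set (ix P + ix Q -> M)),
    hyperdefinable C Q -> @subset_on (quot_prod P Q) gamma ->
    typedef C gamma -> typedef C (dpi Pi gamma).

(* The set of realizations of [Pi|_C]. *)
Definition restr (C : heqset) (P : quot) (Pi : set (pformula M (ix P))) :
    set (ix P -> M) :=
  [set a | dom a /\
     forall D, subset_on D -> typedef C D -> entails_set Pi D -> D a].

Definition defined_on (P Q : quot) (f : (ix P -> M) -> (ix Q -> M) -> Prop)
    (Pi : set (pformula M (ix P))) : Prop :=
  entails_set Pi [set a | exists b, f a b].

(* [f_* Pi] *)
Definition push (P Q : quot) (f : (ix P -> M) -> (ix Q -> M) -> Prop)
    (Pi : set (pformula M (ix P))) : set (pformula M (ix Q)) :=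
  [set phi | exists Gamma,
     [/\ small_type_on Gamma,
         entails_set Pi [set a | exists b, f a b /\ realizations Gamma b] &
         Gamma phi]].

(* [Pi (x) Rho]: contains [gamma(x, y; m)] iff [m] lies in
   [(d_Pi x)((d_Rho y) gamma(x, y, z))]. *)
Definition tensor (P Q : quot) (Pi : set (pformula M (ix P)))
    (Rho : set (pformula M (ix Q))) : set (pformula M (ix (quot_prod P Q))) :=
  [set phi | exists Gamma : set (pformula M (ix (quot_prod P Q))),
     [/\ small_type_on Gamma,
         entails_set Pi [set a | dom a /\
           entails_set Rho [set b | realizations Gamma (join a b)]] &
         Gamma phi]].

Record hyperdef_group (C : heqset) (G : quot)
    (mul : (ix (quot_prod G G) -> M) -> (ix G -> M) -> Prop) : Prop := {
  hg_hyperdef : hyperdefinable C G;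
  hg_fun : @partial_fun C (quot_prod G G) G mul;
  hg_total : forall u v : ix G -> M, dom u -> dom v -> exists w, mul (join u v) w;
  hg_assoc : forall u v w p q r : ix G -> M,
    mul (join u v) p -> mul (join p w) r -> mul (join v w) q -> mul (join u q) r;
  hg_unit_inv : exists e : ix G -> M, dom e /\ forall u : ix G -> M, dom u ->
    [/\ mul (join e u) u, mul (join u e) u &
        exists v, mul (join u v) e /\ mul (join v u) e] }.

Definition left_invariant (G : quot)
    (mul : (ix (quot_prod G G) -> M) -> (ix G -> M) -> Prop)
    (Pi : set (pformula M (ix G))) : Prop :=
  forall g : ix G -> M, dom g -> @push G G (fun h k => mul (join g h) k) Pi = Pi.

(* Equations between values of partial functions assert that both sides are
   defined and equal. *)
Record group_chunk (C : heqset) (P : quot) (Pi : set (pformula M (ix P)))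
    (F H K : (ix (quot_prod P P) -> M) -> (ix P -> M) -> Prop) : Prop := {
  gc_type : partial_type_on Pi;
  gc_closed : closed_under_implication Pi;
  gc_def : type_definable C Pi;
  gc_F : @partial_fun C (quot_prod P P) P F;
  gc_H : @partial_fun C (quot_prod P P) P H;
  gc_K : @partial_fun C (quot_prod P P) P K;
  gc_F_def : @defined_on (quot_prod P P) P F (tensor Pi Pi);
  gc_H_def : @defined_on (quot_prod P P) P H (tensor Pi Pi);
  gc_translate : forall a, restr C Pi a ->
    @push P P (fun x y => F (join a x) y) Pi = Pi;
  gc_cancel : forall a b : ix P -> M,
    @restr C (quot_prod P P) (tensor Pi Pi) (join a b) ->
    exists c, [/\ F (join a b) c, H (join a c) b & K (join b c) a];
  gc_assoc : forall a b c : ix P -> M,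
    @restr C (quot_prod P (quot_prod P P)) (tensor Pi (tensor Pi Pi))
      (join a (join b c)) ->
    exists d e r, [/\ F (join b c) d, F (join a d) r,
                      F (join a b) e & F (join e c) r] }.

End Hyperdefinable.

Arguments dom {L M} q _.
Arguments eqv {L M} q _ _.

(* Main.v *)
Require Import Defs.
From mathcomp Require Import all_boot.
From mathcomp Require Import boolp classical_sets functions cardinality.

(** The group is the group of germs of translations.

    To a partial type [Pi] one attaches the filter of the sets that contain the
    realizations of a small part of [Pi]; membership in it is the quantifier: for
    generic [x].  It is closed under small intersections, and by saturation a set that
    is type-definable over few parameters belongs to it exactly when [Pi] implies it
    ([entails_setP]).  The [C]-type-definable sets are closed under intersections,
    existential quantification over small tuples ([typedef_exists]) and, by
    definability of [Pi], under the generic quantifier ([typedef_filt]).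

    For [a] realizing [Pi|_C], the translation [F_a] is a partial bijection of [P]:
    the cancellation laws make it injective and make [a] recoverable from any of its
    values, and [(F_a)_* Pi = Pi] makes the filter invariant under direct and inverse
    images ([chunk_op_pres]).  Two such bijections have the same germ when they agree
    at a generic point; germs form a group under
    composition.
    Associativity says that [F_a F_b = F_(a b)] on germs for [b] generic over [a]
    ([chunk_op_mult]).

    The fractions [F_a F_b^-1] are closed under products.  The point is to rewrite
    [F_b^-1 F_c] as [F_e' F_e^-1] with [e], [e'] as generic as desired: the translates
    of a set in the filter by [b] and by [c] meet, so [b e' = c e] for such [e], [e'],
    and then [F_b F_e' = F_c F_e] ([left_frac], [frac_mul]).  So [G] is the set of
    pairs of realizations of [Pi|_C] modulo equality of the germs of their fractions;
    equality and multiplication are instances of the generic quantifier, hence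
    [C]-type-definable ([typedef_germ_eq]).

    The map [f] sends [a] to the germ of [F_a], which is a fraction because
    [F_a = F_(a b) F_b^-1].  A fraction [g] also acts on [P], preserving the filter,
    and [f (g a) = g f(a)] for generic [a] ([frac_equivariant]); this gives the left
    invariance of [f_* Pi].

    If [Pi] is inconsistent nothing realizes [Pi|_C], and the trivial group is taken
    instead. *)

Set Implicit Arguments.
Unset Strict Implicit.
Unset Printing Implicit Defensive.

Local Open Scope classical_set_scope.
Local Open Scope card_scope.

(** * Small cardinalities *)

Section Smallness.
Variables (kappa : Type).
Hypotheses (kappa_nat : small kappa [set: nat]) (kappa_reg : regular_cardinal kappa).

Lemma small_le (T U : Type) (A : set T) (B : set U) :
  A #<= B -> small kappa B -> small kappa A.
Proof.
move=> AB [Bk kB]; split; first exact: card_le_trans AB Bk.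
by move=> kA; apply: kB; apply: card_le_trans kA AB.
Qed.

Lemma small_image (T U : Type) (f : T -> U) (A : set T) :
  small kappa A -> small kappa (f @` A).
Proof. exact/small_le/card_image_le. Qed.

Lemma small_subset (T : Type) (A B : set T) :
  A `<=` B -> small kappa B -> small kappa A.
Proof. by move=> /subset_card_le/small_le; apply. Qed.

Lemma small_surj (T U : Type) (f : T -> U) :
  (forall u, exists t, f t = u) -> small kappa [set: T] -> small kappa [set: U].
Proof.
move=> fS /(small_image f); apply: small_subset => u _.
by have [t <-] := fS u; exists t.
Qed.

Lemma small_sig (T : Type) (A : set T) :
  small kappa A -> small kappa [set: {x | A x}].
Proof.
have := card_setT A; rewrite card_eq_le => /andP[AA _] /(small_le AA).
apply: (@small_surj _ _ (fun x : A => exist A (set_val x) (set_valP x))).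
case=> x Ax; exists (exist _ x (mem_set Ax)); exact: eq_exist.
Qed.

Lemma small_bigcup (I T : Type) (A : I -> set T) :
  small kappa [set: I] -> (forall i, small kappa (A i)) ->
  small kappa (\bigcup_i A i).
Proof.
move=> sI sA; have := kappa_reg sI (fun i => small_sig (sA i)).
move=> /(small_image (fun u => proj1_sig (projT2 u))); apply: small_subset.
by move=> x [i _ Aix]; exists (existT _ i (exist _ x Aix)).
Qed.

Lemma small_finite (T : Type) (A : set T) : finite_set A -> small kappa A.
Proof. by move=> /finite_set_countable fA; apply: small_le fA kappa_nat. Qed.

Lemma small_sum (T U : Type) : small kappa [set: T] -> small kappa [set: U] ->
  small kappa [set: T + U].
Proof.
move=> sT sU.
have sbool : small kappa [set: bool] by apply/small_finite/finite_finset.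
have : small kappa [set: {b : bool & if b then T else U}].
  by apply: kappa_reg sbool _ => -[].
apply: (@small_surj _ _ (fun u : {b : bool & if b then T else U} =>
  match u with existT true t => inl t | existT false x => inr x end)).
pose TU b := if b then T else U.
by case=> x; [exists (existT TU true x)|exists (existT TU false x)].
Qed.

Lemma small_setU (T : Type) (A B : set T) : small kappa A -> small kappa B ->
  small kappa (A `|` B).
Proof.
move=> sA sB; have := small_sum (small_sig sA) (small_sig sB).
move=> /(small_image (fun u =>
  match u with inl x => proj1_sig x | inr x => proj1_sig x end)).
apply: small_subset => x [Ax|Bx].
  by exists (inl (exist _ x Ax)).
by exists (inr (exist _ x Bx)).
Qed.

Lemma small_unit : small kappa [set: unit].
Proof. exact/small_finite/finite_finset. Qed.

Lemma small_prod (T U : Type) : small kappa [set: T] -> small kappa [set: U] ->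
  small kappa [set: T * U].
Proof.
move=> sT sU; have := kappa_reg sT (fun=> sU).
apply: (@small_surj _ _ (fun u : {_ : T & U} => (projT1 u, projT2 u))).
by case=> t u; exists (existT _ t u).
Qed.

Lemma small_option (T : Type) : small kappa [set: T] ->
  small kappa [set: option T].
Proof.
move=> sT; have := small_sum sT small_unit.
apply: (@small_surj _ _ (fun u => if u is inl t then Some t else None)).
by case=> [t|]; [exists (inl t)|exists (inr tt)].
Qed.

Lemma small_ffun (n : nat) (T : Type) : small kappa [set: T] ->
  small kappa [set: 'I_n -> T].
Proof.
move=> sT; elim: n => [|n IHn].
  have f0 : 'I_0 -> T by case.
  apply: (@small_surj _ _ (fun=> f0)) small_unit => f; exists tt.
  by apply: funext => -[].
have := small_prod IHn sT.
apply: (@small_surj _ _ (fun u i => if unlift ord0 i is Some j then u.1 j else u.2)).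
move=> f; exists (fun j => f (lift ord0 j), f ord0); apply: funext => i /=.
by case: unliftP => [j|] ->.
Qed.

Lemma small_seq (T : Type) : small kappa [set: T] -> small kappa [set: seq T].
Proof.
move=> sT; have := kappa_reg kappa_nat (fun n => small_ffun n sT).
apply: (@small_surj _ _
  (fun u : {n & 'I_n -> T} => [seq projT2 u i | i <- enum 'I_(projT1 u)])).
move=> s; exists (existT _ (size s) (tnth (in_tuple s))) => /=.
exact: map_tnth_enum.
Qed.

Section SmallFormulas.
Variable L : language.
Hypotheses (funs_small : small kappa [set: fun_sym L])
  (rels_small : small kappa [set: rel_sym L]).

(** Terms nested at most [n] deep.  Counting terms by depth, and likewise formulas,
    reduces their number to unions that regularity of [kappa] controls. *)
Fixpoint term_depth (V : Type) (n : nat) : Type :=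
  if n is n'.+1 then
    (term_depth V n' +
     {f : fun_sym L & 'I_(fun_arity f) -> term_depth V n'})%type
  else V.

Fixpoint term_of_depth (V : Type) (n : nat) : term_depth V n -> term L V :=
  match n return term_depth V n -> term L V with
  | 0 => fun v => Var L v
  | n'.+1 => fun u => match u with
      | inl t => term_of_depth t
      | inr ts => App (fun i => term_of_depth (projT2 ts i))
      end
  end.

Lemma term_depth_widen (V : Type) (n m : nat) (t : term_depth V n) : n <= m ->
  exists u : term_depth V m, term_of_depth u = term_of_depth t.
Proof.
move=> /subnK <-; elim: (m - n) => [|k [u ut]]; first by exists t.
by exists (inl u).
Qed.

Lemma term_has_depth (V : Type) (t : term L V) :
  exists n (u : term_depth V n), term_of_depth u = t.
Proof.
elim: t => [v|f ts /choice[d ud]]; first by exists 0, v.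
have {ud}/choice[us usE] i :
    exists u : term_depth V (\max_i d i), term_of_depth u = ts i.
  by have [u <-] := ud i; apply: term_depth_widen; apply: leq_bigmax.
exists (\max_i d i).+1, (inr (existT _ f us)).
by congr App; apply: funext => i; apply: usE.
Qed.

Lemma small_term (V : Type) : small kappa [set: V] ->
  small kappa [set: term L V].
Proof.
move=> sV; have sd n : small kappa [set: term_depth V n].
  elim: n => //= n IHn; apply: small_sum => //.
  by apply: kappa_reg => // f; apply: small_ffun.
apply: (@small_surj _ _ (fun u => term_of_depth (projT2 u)))
  (kappa_reg kappa_nat sd) => t.
by have [n [u <-]] := term_has_depth t; exists (existT _ n u).
Qed.

(** The type of variables grows with each quantifier, so [V] varies along the
    recursion. *)
Fixpoint formula_depth (V : Type) (n : nat) : Type :=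
  if n is n'.+1 then
    (formula_depth V n' + (formula_depth V n' * formula_depth V n') +
     formula_depth (option V) n')%type
  else
    (unit + (term L V * term L V) +
     {r : rel_sym L & 'I_(rel_arity r) -> term L V})%type.

Fixpoint formula_of_depth (V : Type) (n : nat) :
    formula_depth V n -> formula L V :=
  match n return formula_depth V n -> formula L V with
  | 0 => fun u => match u with
      | inl (inl _) => Bot
      | inl (inr (t1, t2)) => Equal t1 t2
      | inr ts => Rel (projT2 ts)
      end
  | n'.+1 => fun u => match u with
      | inl (inl u1) => formula_of_depth u1
      | inl (inr (u1, u2)) => Imp (formula_of_depth u1) (formula_of_depth u2)
      | inr u1 => All (formula_of_depth u1)
      end
  end.

Lemma formula_depth_widen (V : Type) (n m : nat) (t : formula_depth V n) :
  n <= m ->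
  exists u : formula_depth V m, formula_of_depth u = formula_of_depth t.
Proof.
move=> /subnK <-; elim: (m - n) => [|k [u ut]]; first by exists t.
by exists (inl (inl u)).
Qed.

Lemma formula_has_depth (V : Type) (phi : formula L V) :
  exists n (u : formula_depth V n), formula_of_depth u = phi.
Proof.
elim: {V} phi => [V|V t1 t2|V r ts|V p1 [n1 [u1 <-]] p2 [n2 [u2 <-]]|V p [n [u <-]]].
- by exists 0, (inl (inl tt)).
- by exists 0, (inl (inr (t1, t2))).
- by exists 0, (inr (existT _ r ts)).
- have [v1 <-] := formula_depth_widen u1 (leq_maxl n1 n2).
  have [v2 <-] := formula_depth_widen u2 (leq_maxr n1 n2).
  by exists (maxn n1 n2).+1, (inl (inr (v1, v2))).
- by exists n.+1, (inr u).
Qed.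

Lemma small_formula (V : Type) : small kappa [set: V] ->
  small kappa [set: formula L V].
Proof.
move=> sV; have sd n : small kappa [set: formula_depth V n].
  elim: n V sV => [|n IHn] V sV /=.
    apply: small_sum.
      apply: small_sum; first exact: small_unit.
      by apply: small_prod; apply: small_term.
    by apply: kappa_reg => // r; apply/small_ffun/small_term.
  have sn := IHn V sV.
  by repeat (apply: small_sum || apply: small_prod) => //;
    apply/IHn/small_option.
apply: (@small_surj _ _ (fun u => formula_of_depth (projT2 u)))
  (kappa_reg kappa_nat sd) => t.
by have [n [u <-]] := formula_has_depth t; exists (existT _ n u).
Qed.

End SmallFormulas.
End Smallness.

(** * Quantifying over small tuples *)

Section Formulas.
Variable L : language.

Fixpoint rename_term (V W : Type) (f : V -> W) (t : term L V) : term L W :=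
  match t with
  | Var v => Var L (f v)
  | App g ts => App (fun i => rename_term f (ts i))
  end.

Fixpoint rename (V W : Type) (f : V -> W) (phi : formula L V) {struct phi} :
    formula L W :=
  match phi with
  | Bot => Bot
  | Equal t u => Equal (rename_term f t) (rename_term f u)
  | Rel r ts => Rel (fun i => rename_term f (ts i))
  | Imp p q => Imp (rename f p) (rename f q)
  | All p => All (rename (omap f) p)
  end.

Variable M : structure L.

Lemma join_eta (T I J : Type) (c : I + J -> T) : join (c \o inl) (c \o inr) = c.
Proof. by apply: funext => -[]. Qed.

Lemma comp_join (T U I J : Type) (h : T -> U) (a : I -> T) (b : J -> T) :
  h \o join a b = join (h \o a) (h \o b).
Proof. by apply: funext => -[]. Qed.

Lemma eval_rename (V W : Type) (f : V -> W) (e : W -> M) (t : term L V) :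
  eval e (rename_term f t) = eval (e \o f) t.
Proof. by elim: t => //= g ts IH; congr fun_interp; apply: funext. Qed.

Lemma sat_rename (V W : Type) (f : V -> W) (e : W -> M) (phi : formula L V) :
  sat e (rename f phi) = sat (e \o f) phi.
Proof.
elim: phi W f e => {V} [V|V t u|V r ts|V p IHp q IHq|V p IH] W f e //=.
- by rewrite !eval_rename.
- by congr rel_interp; apply: funext => i; rewrite eval_rename.
- by rewrite IHp IHq.
- apply: eq_forall => m; rewrite IH; congr sat.
  by apply: funext => -[].
Qed.

(** The quantifier of the language binds one variable; to quantify over an infinite
    tuple one needs that a formula depends on finitely many coordinates. *)
Lemma eval_finite_support (V : Type) (t : term L V) :
  exists2 W : set V, finite_set W & forall e e' : V -> M,
    {in W, e =1 e'} -> eval e t = eval e' t.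
Proof.
elim: t => [v|f ts IH].
  by exists [set v] => // e e'; apply; rewrite inE.
have {IH}/choice[W IH] i : exists W : set V, finite_set W /\
    forall e e' : V -> M, {in W, e =1 e'} -> eval e (ts i) = eval e' (ts i).
  by have [W] := IH i; exists W.
exists (\bigcup_i W i) => [|e e' ee' /=].
  by apply: bigcup_finite => // i _; have [] := IH i.
congr fun_interp; apply: funext => i; apply: (IH i).2 => v /set_mem Wv.
by apply: ee'; apply/mem_set; exists i.
Qed.

Lemma sat_finite_support (V : Type) (phi : formula L V) :
  exists2 W : set V, finite_set W & forall e e' : V -> M,
    {in W, e =1 e'} -> sat e phi = sat e' phi.
Proof.
elim: phi => {V} [V|V t u|V r ts|V p [Wp finp IHp] q [Wq finq IHq]|V p [W finW IH]].
- by exists set0.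
- have [Wt fint Wtp] := eval_finite_support t.
  have [Wu finu Wup] := eval_finite_support u.
  exists (Wt `|` Wu); first by rewrite finite_setU.
  move=> e e' ee' /=; rewrite (Wtp e e') ?(Wup e e') // => v /set_mem Wv.
    by apply: ee'; apply/mem_set; right.
  by apply: ee'; apply/mem_set; left.
- have /choice[W IH] i : exists W : set V, finite_set W /\
      forall e e' : V -> M, {in W, e =1 e'} -> eval e (ts i) = eval e' (ts i).
    by have [W] := eval_finite_support (ts i); exists W.
  exists (\bigcup_i W i) => [|e e' ee' /=].
    by apply: bigcup_finite => // i _; have [] := IH i.
  congr rel_interp; apply: funext => i; apply: (IH i).2 => v /set_mem Wv.
  by apply: ee'; apply/mem_set; exists i.
- exists (Wp `|` Wq); first by rewrite finite_setU.
  move=> e e' ee' /=; rewrite (IHp e e') ?(IHq e e') // => v /set_mem Wv.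
    by apply: ee'; apply/mem_set; right.
  by apply: ee'; apply/mem_set; left.
- exists (Some @^-1` W).
    by apply: finite_preimage finW => x y _ _ [].
  move=> e e' ee' /=; apply: eq_forall => m; apply: IH => -[v|] Wv //=.
  by apply: ee'; apply/mem_set/set_mem.
Qed.

Definition not_formula (V : Type) (phi : formula L V) := Imp phi Bot.

Definition conj_formula (V : Type) (s : seq (formula L V)) : formula L V :=
  not_formula (foldr (fun phi psi => Imp phi psi) Bot s).

Lemma sat_conj_formula (V : Type) (e : V -> M) (s : seq {classic (formula L V)}) :
  sat e (conj_formula s) <-> forall phi, phi \in s -> sat e phi.
Proof.
rewrite /conj_formula /not_formula /=.
have -> : sat e (foldr (fun phi psi => Imp phi psi) Bot s) <->
    ~ forall phi, phi \in s -> sat e phi; last first.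
  by split=> [/contrapT|h /(_ h)].
elim: s => [|phi s IHs] /=; first by split=> // h; apply: h.
rewrite IHs; split=> [h hs|h ephi hs]; last first.
  by apply: h => psi /[1!inE] /orP[/eqP->//|/hs].
apply: h => [|psi psis]; first by apply: hs; rewrite inE eqxx.
by apply: hs; rewrite inE psis orbT.
Qed.

Lemma forall_ord_formula (n : nat) (V : Type) (phi : formula L (V + 'I_n)) :
  exists psi : formula L V, forall e : V -> M,
    sat e psi <-> forall z : 'I_n -> M, sat (join e z) phi.
Proof.
elim: n V phi => [|n IHn] V phi.
  pose g (u : V + 'I_0) : V := match u with
    | inl v => v
    | inr i => False_rect V (notF (ltn_ord i))
    end.
  exists (rename g phi) => e; rewrite sat_rename.
  have eg (z : 'I_0 -> M) : e \o g = join e z.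
    by apply: funext => -[v|[]].
  split=> [h z|h]; first by rewrite -eg.
  have [m] := carrier_inhabited M.
  by rewrite (eg (fun=> m)).
pose g (u : V + 'I_n.+1) : option V + 'I_n := match u with
  | inl v => inl (Some v)
  | inr i => if unlift ord0 i is Some j then inr j else inl None
  end.
have [psi psiE] := IHn _ (rename g phi).
exists (All psi) => e /=; split=> [h z|h m].
  have /psiE/(_ (z \o lift ord0)) := h (z ord0).
  rewrite sat_rename; congr sat; apply: funext => -[v|i] //=.
  by case: unliftP => [j|] /= ->.
apply/psiE => z; rewrite sat_rename.
have := h (fun i => if unlift ord0 i is Some j then z j else m).
congr sat; apply: funext => -[v|i] //=.
by case: unliftP.
Qed.

(** The finitely many coordinates in [J] on which [phi] depends are renamed to
    [0, ..., n - 1]; the others share the extra variable [n], which is there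
    even when the support is empty. *)
Lemma forall_formula (V J : Type) (phi : formula L (V + J)) :
  exists psi : formula L V, forall e : V -> M,
    sat e psi <-> forall z : J -> M, sat (join e z) phi.
Proof.
have [W finW Wphi] := sat_finite_support phi.
have /finite_seqP[s sE] : finite_set (inr @^-1` W : set {classic J}).
  by apply: finite_preimage finW => x y _ _ [].
pose g (u : V + J) : V + 'I_(size s).+1 := match u with
  | inl v => inl v
  | inr j => inr (inord (index (j : {classic J}) s))
  end.
have [psi psiE] := forall_ord_formula (rename g phi).
have [m0] := carrier_inhabited M.
exists psi => e; rewrite psiE; split=> h z; last first.
  rewrite sat_rename; have := h (fun j => z (inord (index (j : {classic J}) s))).
  by congr sat; apply: funext => -[].
have := h (fun i => nth m0 [seq z j | j <- s] i); rewrite sat_rename.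
rewrite (Wphi _ (join e z)) // => -[v //|j] /set_mem Wj /=.
have js : (j : {classic J}) \in s by have : [set` s] j by rewrite -sE.
rewrite inordK ?ltnS ?index_size // (nth_map j) ?index_mem //.
by congr z; apply: (@nth_index {classic J}).
Qed.

Lemma exists_conj_formula (V J : Type) (s : seq (formula L (V + J))) :
  exists psi : formula L V, forall e : V -> M,
    sat e psi <-> exists z : J -> M,
      forall phi, phi \in (s : seq {classic _}) -> sat (join e z) phi.
Proof.
have [psi psiE] := forall_formula (not_formula (conj_formula s)).
exists (not_formula psi) => e /=; rewrite psiE; split.
  by move=> /existsNP[z] /contrapT /sat_conj_formula; exists z.
by move=> [z /sat_conj_formula ez] /(_ z); apply.
Qed.

Lemma finite_image_seq (T U : Type) (g : T -> U) (A : set U) :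
  finite_set A -> A `<=` range g ->
  exists s : seq {classic T}, A `<=` g @` [set` s].
Proof.
move=> finA; have /finite_seqP[t ->] : finite_set (A : set {classic U}) by [].
elim: t => [|u t IHt] tg; first by exists [::].
have [|s ts] := IHt; first by move=> v vt; apply: tg; rewrite /= inE vt orbT.
have [|x _ xu] := tg u; first by rewrite /= inE eqxx.
exists (x :: s) => v /=; rewrite inE => /orP[/eqP->|/ts[y ys yv]].
  by exists x; rewrite //= inE eqxx.
by exists y; rewrite //= inE ys orbT.
Qed.

(** Saturation turns an existential quantifier over a small tuple into a partial
    type: the formulas [exists z, phi_1 /\ ... /\ phi_n], with the [phi_i] taken
    from [Phi], say that [Phi(e, z)] is finitely satisfiable in [z]. *)
Lemma exists_zeroset (kappa V J : Type) (Phi : set (formula L (V + J))) :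
  small kappa [set: nat] -> regular_cardinal kappa -> saturated M kappa ->
  small kappa [set: J] -> small kappa Phi ->
  exists2 Psi : set (formula L V), small kappa Psi &
    forall e : V -> M, zeroset Psi e <-> exists z, zeroset Phi (join e z).
Proof.
move=> snat reg satM sJ sPhi.
have /choice[ex exE] (s : seq {phi | Phi phi}) : exists psi : formula L V,
    forall e : V -> M, sat e psi <-> exists z : J -> M,
      forall p, p \in (s : seq {classic _}) -> sat (join e z) (proj1_sig p).
  have [psi psiE] := exists_conj_formula [seq proj1_sig p | p <- s].
  exists psi => e; rewrite psiE; split=> -[z ez]; exists z.
    move=> p ps; apply: ez; apply/(@mapP {classic _} {classic _}).
    by exists p.
  by move=> _ /(@mapP {classic _} {classic _})[p ps ->]; apply: ez.
exists (range ex); first by apply/small_image/small_seq/small_sig.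
move=> e; split; last first.
  by move=> [z ez] _ [s _ <-]; apply/exE; exists z => -[phi Pphi] _; apply: ez.
move=> ePsi.
pose plug (p : {phi | Phi phi}) : pformula M J :=
  rename (join (inr \o e) inl) (proj1_sig p).
have psat_plug z p : psat z (plug p) = sat (join e z) (proj1_sig p).
  rewrite /psat sat_rename; congr sat.
  by apply: funext => -[].
have [|Gam0 fin0 sub0|z zG] := satM J (range plug) sJ.
- exact/small_image/small_sig.
- have [s sE] := finite_image_seq fin0 sub0.
  have /exE[z ez] := ePsi _ (imageT ex s).
  by exists z => _ /sE[p ps <-]; rewrite psat_plug; apply: ez.
- exists z => phi Pphi.
  by rewrite -(psat_plug z (exist _ phi Pphi)); apply: zG; exists (exist _ phi Pphi).
Qed.
End Formulas.

(** * Type-definable sets and the filter of a partial type *)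

Section TypeDefinable.
Variables (L : language) (T : set (sentence L)) (kappa : Type) (M : structure L).
Hypothesis hM : monster M T kappa.

Let kappa_nat := monster_uncountable hM.
Let kappa_reg := monster_regular hM.
Let satM := monster_saturated hM.

Lemma small_formulaM (V : Type) :
  small kappa [set: V] -> small kappa [set: formula L V].
Proof.
by apply: small_formula; [|exact: monster_regular hM|exact: monster_funs hM|
  exact: monster_rels hM].
Qed.

(** Type-definability over arbitrary small parameters. *)
Definition stype (I : Type) (D : set (I -> M)) : Prop :=
  exists2 Gamma : set (pformula M I), small kappa Gamma & realizations Gamma = D.

Lemma stype_bigcap (K I : Type) (D : K -> set (I -> M)) :
  small kappa [set: K] -> (forall k, stype (D k)) ->
  stype [set a | forall k, D k a].
Proof.
move=> sK /(_ _)/cid2-/all_sig2[G sG DE].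
exists (\bigcup_k G k); first exact: small_bigcup.
apply/seteqP; split=> a aD => [k|phi [k _ Gphi]].
  by rewrite -DE => phi Gphi; apply: aD; exists k.
by have := aD k; rewrite -DE; apply.
Qed.

Lemma stype_setI (I : Type) (A B : set (I -> M)) :
  stype A -> stype B -> stype [set a | A a /\ B a].
Proof.
move=> sA sB.
have := @stype_bigcap bool I (fun b => if b then A else B).
rewrite (_ : [set a | _] = [set a | A a /\ B a]).
  by apply=> [|[]//]; apply: small_finite => //; apply: finite_finset.
apply/seteqP; split=> a /= h; last by case: h => ? ? [].
by split; [apply: (h true)|apply: (h false)].
Qed.

Lemma stype_subst (I J : Type) (D : set (J -> M)) (g : J -> I + M) :
  stype D -> stype [set a | D (join a id \o g)].
Proof.
move=> [G sG <-]; exists (rename (join g inr) @` G); first exact: small_image.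
have gE (a : I -> M) phi :
    psat a (rename (join g inr) phi) = psat (join a id \o g) phi.
  rewrite /psat sat_rename; congr sat.
  by apply: funext => -[].
apply/seteqP; split=> a /= aG => [phi Gphi|_ [phi Gphi <-]].
  by rewrite -gE; apply: aG; exists phi.
by rewrite gE; apply: aG.
Qed.

Lemma stype_preim (I J : Type) (f : J -> I) (D : set (J -> M)) :
  stype D -> stype [set a : I -> M | D (a \o f)].
Proof. by move=> /(@stype_subst I J D (inl \o f)). Qed.

Lemma stype_slice (I J : Type) (D : set (I + J -> M)) (b : J -> M) :
  stype D -> stype [set a | D (join a b)].
Proof.
move=> /(stype_subst (join inl (inr \o b))); congr stype.
by apply/seteqP; split=> a /=; rewrite comp_join.
Qed.

Lemma stype_slicel (I J : Type) (D : set (I + J -> M)) (a : I -> M) :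
  stype D -> stype [set b | D (join a b)].
Proof.
move=> /(stype_subst (join (inr \o a) inl)); congr stype.
by apply/seteqP; split=> b /=; rewrite comp_join.
Qed.

Lemma stype_exists (I J : Type) (D : set (I + J -> M)) :
  small kappa [set: J] -> stype D -> stype [set a | exists z, D (join a z)].
Proof.
move=> sJ [G sG <-].
pose g (u : I + J + M) : I + M + J := match u with
  | inl (inl i) => inl (inl i) | inl (inr j) => inr j | inr m => inl (inr m) end.
have gE (a : I -> M) (z : J -> M) : zeroset (rename g @` G) (join (join a id) z) <->
    realizations G (join a z).
  have E phi : sat (join (join a id) z) (rename g phi) = psat (join a z) phi.
    rewrite sat_rename /psat; congr sat.
    by apply: funext => -[[]|].
  split=> [h phi Gphi|h _ [phi Gphi <-]].
    by rewrite -E; apply: h; exists phi.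
  by rewrite E; apply: h.
have [Psi sPsi PsiE] := exists_zeroset kappa_nat kappa_reg satM sJ
  (small_image (rename g) sG).
exists Psi => //; apply/seteqP; split=> a /=.
  by move=> /PsiE[z /gE]; exists z.
by move=> [z /gE za]; apply/PsiE; exists z.
Qed.

Lemma typedef0_bigcap (K I : Type) (D : K -> set (I -> M)) :
  (forall k, typedef0 (D k)) -> typedef0 [set a | forall k, D k a].
Proof.
move=> /choice[G DE]; exists (\bigcup_k G k).
apply/seteqP; split=> a aD => [phi [k _ Gphi]|k].
  by have := aD k; rewrite DE; apply.
by rewrite DE => phi Gphi; apply: aD; exists k.
Qed.

Lemma typedef0_preim (I J : Type) (f : J -> I) (D : set (J -> M)) :
  typedef0 D -> typedef0 [set a : I -> M | D (a \o f)].
Proof.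
move=> [G ->]; exists (rename f @` G).
apply/seteqP; split=> a aD => [_ [phi Gphi <-]|phi Gphi].
  by rewrite sat_rename; apply: aD.
by have := aD (rename f phi); rewrite sat_rename; apply; exists phi.
Qed.

Lemma typedef0_exists (I J : Type) (D : set (I + J -> M)) :
  small kappa [set: I] -> small kappa [set: J] ->
  typedef0 D -> typedef0 [set a | exists z, D (join a z)].
Proof.
move=> sI sJ [G ->].
have sG : small kappa G.
  by apply: small_subset (small_formulaM (small_sum kappa_nat kappa_reg sI sJ)).
have [Psi sPsi PsiE] := exists_zeroset kappa_nat kappa_reg satM sJ sG.
by exists Psi; apply/seteqP; split=> a /PsiE.
Qed.

Section OverC.
Variable C : heqset kappa M.

Lemma small_hs_var : small kappa [set: hs_var C].
Proof.
by apply: kappa_reg => [|s]; [exact: hs_small|case: (hi_sortP (hs_el s))].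
Qed.

Lemma typedef_bigcap (K I : Type) (D : K -> set (I -> M)) (k0 : K) :
  (forall k, typedef C (D k)) -> typedef C [set a | forall k, D k a].
Proof.
move=> /choice[G DE]; exists (\bigcup_k G k); split=> [x y xy|x y y' yy' xy|].
- by have [+ _ _] := DE k0; apply=> phi Gphi; apply: xy; exists k0.
- move=> phi [k _ Gphi]; have [_ inv _] := DE k; apply: (inv x y y') => //.
  by move=> psi Gpsi; apply: xy; exists k.
apply/seteqP; split=> a aD => [phi [k _ Gphi]|k].
  by have := aD k; have [_ _ ->] := DE k; apply.
by have [_ _ ->] := DE k => phi Gphi; apply: aD; exists k.
Qed.

Lemma typedef_setI (I : Type) (A B : set (I -> M)) :
  typedef C A -> typedef C B -> typedef C [set a | A a /\ B a].
Proof.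
move=> sA sB.
have := @typedef_bigcap bool I (fun b => if b then A else B) true.
rewrite (_ : [set a | _] = [set a | A a /\ B a]); first by apply=> -[].
apply/seteqP; split=> a /= h; last by case: h => ? ? [].
by split; [apply: (h true)|apply: (h false)].
Qed.

Lemma typedef_preim (I J : Type) (f : J -> I) (D : set (J -> M)) :
  typedef C D -> typedef C [set a : I -> M | D (a \o f)].
Proof.
move=> [G [Gdom Ginv ->]].
pose g (u : J + hs_var C) : I + hs_var C := match u with
  | inl j => inl (f j) | inr v => inr v end.
have gE a y : zeroset (rename g @` G) (join a y) <-> zeroset G (join (a \o f) y).
  have E phi : sat (join a y) (rename g phi) = sat (join (a \o f) y) phi.
    by rewrite sat_rename; congr sat; apply: funext => -[].
  split=> [h phi Gphi|h _ [phi Gphi <-]].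
    by rewrite -E; apply: h; exists phi.
  by rewrite E; apply: h.
exists (rename g @` G); split=> [x y /gE|x y y' yy' /gE xy|]; first exact: Gdom.
  by apply/gE; apply: (Ginv _ y).
by apply/seteqP; split=> a /gE.
Qed.

Lemma typedef_exists (I J : Type) (D : set (I + J -> M)) :
  small kappa [set: I] -> small kappa [set: J] ->
  typedef C D -> typedef C [set a | exists z, D (join a z)].
Proof.
move=> sI sJ [G [Gdom Ginv ->]].
pose g (u : I + J + hs_var C) : I + hs_var C + J := match u with
  | inl (inl i) => inl (inl i) | inl (inr j) => inr j | inr v => inl (inr v) end.
have : typedef0 [set c : I + hs_var C + J -> M | zeroset G (c \o g)].
  by apply: typedef0_preim; exists G.
move=> /(typedef0_exists (small_sum kappa_nat kappa_reg sI small_hs_var) sJ).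
move=> [Psi PsiE]; exists Psi; rewrite -PsiE.
have gE a y z : join (join a y) z \o g = join (join a z) y.
  by apply: funext => -[[]|].
split=> [x y [z]|x y y' yy' [z]|].
- by rewrite /= gE; apply: Gdom.
- by rewrite /= gE => xyz; exists z; rewrite /= gE; apply: (Ginv _ y).
- by apply/seteqP; split=> a /= [z za]; exists z; move: za; rewrite /= gE.
Qed.

(** A parameter-free type defines a set over any [C] once the conditions that the
    parameters lie in their sorts are added to it. *)
Lemma typedef_of0 (I : Type) (D : set (I -> M)) : typedef0 D -> typedef C D.
Proof.
move=> D0.
have : typedef0 [set c : I + hs_var C -> M | forall o : option (hs_ix C),
    if o is Some s then dom (hi_sort (hs_el s)) (@component _ _ _ C (c \o inr) s)
    else D (c \o inl)].
  apply: typedef0_bigcap => -[s|]; last exact: typedef0_preim.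
  have [_ [_ [dom0 _]]] := hi_sortP (hs_el s).
  by apply: (typedef0_preim
    (fun i => inr (existT (fun s => ix (hi_sort (hs_el s))) s i))) dom0.
move=> [Psi PsiE]; exists Psi; rewrite -PsiE; split=> [x y xy s|x y y' yy' xy|].
- exact: (xy (Some s)).
- case=> [s|]; last exact: (xy None).
  have [_ [_ [_ [_ [eqdom _]]]]] := hi_sortP (hs_el s).
  by have [] := eqdom _ _ (yy' s).
apply/seteqP; split=> a /= => [aD [s|//]|/(_ None)//].
exact: (hi_repP (hs_el s)).
Qed.

Lemma typedef_setT (I : Type) : typedef C [set: I -> M].
Proof.
by apply: typedef_of0; exists set0; apply/seteqP; split=> // a _ phi [].
Qed.

Lemma typedef_eq (I J : Type) (f g : J -> I) :
  typedef C [set a : I -> M | a \o f = a \o g].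
Proof.
apply: typedef_of0; exists (range (fun j => Equal (Var L (f j)) (Var L (g j)))).
apply/seteqP; split=> a /= => [aE _ [j _ <-] /=|h].
  exact: (congr1 (fun h => h j) aE).
by apply: funext => j; apply: (h (Equal (Var L (f j)) (Var L (g j)))); exists j.
Qed.

Lemma typedef_stype (I : Type) (D : set (I -> M)) :
  small kappa [set: I] -> typedef C D -> stype D.
Proof.
move=> sI [G [_ _ ->]]; apply: stype_slice.
have sG : small kappa G.
  have sIC := small_sum kappa_nat kappa_reg sI small_hs_var.
  by apply: small_subset (small_formulaM sIC).
exists (rename inl @` G); first exact: small_image.
apply/seteqP; split=> a aD => [phi Gphi|_ [phi Gphi <-]].
  by have := aD (rename inl phi); rewrite /psat sat_rename; apply; exists phi.
by rewrite /psat sat_rename; apply: aD.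
Qed.

End OverC.

(** The consequences of [Pi], as a filter on tuples.  Unlike [entails_set] it applies
    to sets that are not type-definable, so it is monotone without side conditions. *)
Definition filt (I : Type) (Pi : set (pformula M I)) : set (set (I -> M)) :=
  [set D | exists Pi0, [/\ small kappa Pi0, Pi0 `<=` Pi & realizations Pi0 `<=` D]].

Lemma filtS (I : Type) (Pi : set (pformula M I)) (A B : set (I -> M)) :
  A `<=` B -> filt Pi A -> filt Pi B.
Proof.
by move=> AB [Pi0 [sPi PiPi0 PiA]]; exists Pi0; split=> //; apply: subset_trans AB.
Qed.

Lemma filt_bigcap (K I : Type) (Pi : set (pformula M I)) (D : K -> set (I -> M)) :
  small kappa [set: K] -> (forall k, filt Pi (D k)) ->
  filt Pi [set a | forall k, D k a].
Proof.
move=> sK /choice[G GE]; exists (\bigcup_k G k); split.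
- by apply: small_bigcup => // k; have [] := GE k.
- by move=> phi [k _]; have [_ + _] := GE k; apply.
- move=> a aG k; have [_ _ GD] := GE k; apply: GD => phi Gphi.
  by apply: aG; exists k.
Qed.

Lemma filt_setI (I : Type) (Pi : set (pformula M I)) (A B : set (I -> M)) :
  filt Pi A -> filt Pi B -> filt Pi [set a | A a /\ B a].
Proof.
move=> [G [sG GPi GA]] [H [sH HPi HB]]; exists (G `|` H); split.
- exact: small_setU.
- by rewrite subUset.
- by move=> a aGH; split; [apply: GA|apply: HB] => phi ?; apply: aGH; [left|right].
Qed.

Lemma filtT (I : Type) (Pi : set (pformula M I)) : filt Pi setT.
Proof.
by exists set0; split=> //; apply: small_le (card_ge0 _ _) kappa_nat.
Qed.


Lemma entails_filt (I : Type) (Pi : set (pformula M I)) (D : set (I -> M)) :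
  entails_set kappa Pi D -> filt Pi D.
Proof.
move=> [G [sG <- Gent]].
have /choice[F FE] (u : {phi | G phi}) : exists Pi0 : set (pformula M I),
    [/\ finite_set Pi0, Pi0 `<=` Pi &
        realizations Pi0 `<=` [set a | psat a (proj1_sig u)]].
  by case: u => phi Gphi; apply: Gent.
exists (\bigcup_u F u); split.
- apply: small_bigcup => //; first exact: small_sig.
  by move=> u; apply: small_finite => //; have [] := FE u.
- by move=> phi [u _]; have [_ + _] := FE u; apply.
- move=> a aF phi Gphi; have [_ _] := FE (exist _ phi Gphi); apply.
  by move=> psi Fpsi; apply: aF; exists (exist _ phi Gphi).
Qed.

(** By saturation, a formula that follows from a small part of [Pi] follows from a
    finite part. *)
Lemma filt_entails (I : Type) (Pi : set (pformula M I)) (phi : pformula M I) :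
  small kappa [set: I] -> filt Pi [set a | psat a phi] -> entails Pi phi.
Proof.
move=> sI [Pi0 [sPi0 sub imp]]; apply: contrapT => nent.
have [|Pi1 fin1 sub1|a aPi] := satM (Gamma := Pi0 `|` [set not_formula phi]) sI.
- by apply: small_setU => //; apply/small_finite => //; apply: finite_set1.
- apply: contrapT => empty; apply: nent; exists (Pi1 `&` Pi0); split.
  + exact: finite_setIl.
  + by apply: subset_trans sub; apply: subIsetr.
  + move=> a a1 /=; apply: contrapT => na; apply: empty; exists a => psi psi1.
    by case: (sub1 _ psi1) => [psi0|->//]; apply: a1.
- have := aPi (not_formula phi) (or_intror erefl); apply.
  by apply: imp => psi psi0; apply: aPi; left.
Qed.

Lemma entails_setP (I : Type) (Pi : set (pformula M I)) (D : set (I -> M)) :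
  small kappa [set: I] ->
  entails_set kappa Pi D <-> stype D /\ filt Pi D.
Proof.
move=> sI; split=> [ent|[[G sG <-] PiG]].
  by split; [case: ent => G [sG GD _]; exists G|apply: entails_filt].
exists G; split=> // phi Gphi; apply: filt_entails => //.
by apply: filtS PiG => a; apply.
Qed.

Section Restriction.
Variables (C : heqset kappa M) (P : quot M).
Hypothesis hP : hyperdefinable C P.

Lemma restr_subset_on (Pi : set (pformula M (ix P))) : subset_on (restr C Pi).
Proof.
have [_ [_ [_ [_ [eqdom _]]]]] := hP.
split=> [a []//|a b ab [_ aR]]; split; first by have [] := eqdom _ _ ab.
by move=> D sD tD eD; apply: sD.2 ab _; apply: aR.
Qed.

Lemma restr_typedef (Pi : set (pformula M (ix P))) : typedef C (restr C Pi).
Proof.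
pose K := {D | subset_on D /\ typedef C D /\ entails_set kappa Pi D}.
have := @typedef_bigcap C (option K) _
  (fun k => if k is Some D then proj1_sig D else dom P) None.
rewrite (_ : [set a | _] = restr C Pi).
  apply=> -[[D Dp] /=|]; first by case: Dp => _ [].
  by case: hP => _ [_ []].
apply/seteqP; split=> a /= => [h|[adom h] [[D [sD [tD eD]]]|]//=].
  split=> [|D sD tD eD]; first exact: (h None).
  exact: (h (Some (exist _ D (conj sD (conj tD eD))))).
exact: h.
Qed.

(** There are only few formulas over [C], so [Pi|_C] is itself implied by [Pi]. *)
Lemma restr_filt (Pi : set (pformula M (ix P))) :
  filt Pi (dom P) -> filt Pi (restr C Pi).
Proof.
move=> Pidom; have [sP _] := hP.
(* One condition for each formula over [C]: it holds if [Pi] implies it. *)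
have : filt Pi [set a | forall phi : formula L (ix P + hs_var C),
    filt Pi [set x | sat (join x (@hs_tuple _ _ _ C)) phi] ->
    sat (join a (@hs_tuple _ _ _ C)) phi].
  apply: filt_bigcap => [|phi].
    exact/small_formulaM/(small_sum kappa_nat kappa_reg sP)/small_hs_var.
  have [Piphi|nPiphi] :=
    pselect (filt Pi [set x | sat (join x (@hs_tuple _ _ _ C)) phi]).
    by apply: filtS Piphi => a.
  by apply: filtS (filtT Pi).
move=> /(filt_setI Pidom); apply: filtS => a [adom aphi].
split=> // D sD [Phi [_ _ DE]] /entails_filt eD; rewrite DE => phi Phiphi.
by apply: aphi; apply: filtS eD => x; rewrite DE; apply.
Qed.

End Restriction.

Definition real_quot (I : Type) : quot M :=
  @Quot L M I setT (fun a b => a = b).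

Lemma real_quot_hyperdefinable (C : heqset kappa M) (I : Type) :
  small kappa [set: I] -> hyperdefinable C (real_quot I).
Proof.
move=> sI; have [m] := carrier_inhabited M.
split=> //; split; first by exists (fun=> m).
split; first exact: typedef_setT.
split; first exact: (typedef_eq C (@inl I I) (@inr I I)).
by split=> //; split=> //; split=> [a b ->|a b c -> ->].
Qed.

(** Definability of [Pi] gives closure of the [C]-type-definable sets under the
    quantifier [Pi(x) |- ...].  Testing it on real tuples suffices. *)
Lemma typedef_filt (C : heqset kappa M) (P : quot M)
    (Pi : set (pformula M (ix P))) (I : Type) (D : set (ix P + I -> M)) :
  type_definable C Pi -> small kappa [set: ix P] -> small kappa [set: I] ->
  typedef C D -> (forall b, @subset_on _ _ P [set x | D (join x b)]) ->
  typedef C [set b | filt Pi [set x | D (join x b)]].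
Proof.
move=> defPi sP sI tD Don.
have := defPi (real_quot I) D (real_quot_hyperdefinable C sI).
rewrite (_ : dpi (Q := real_quot I) kappa Pi D =
  [set b | filt Pi [set x | D (join x b)]]).
  apply=> //; split=> [c|c d [cd1 cd2]].
    by rewrite -[c]join_eta => /(Don _).1.
  rewrite -[c]join_eta -[d]join_eta cd2.
  exact: (Don (d \o inr)).2.
apply/seteqP; split=> b /= => [[_ /entails_filt]//|bD]; split=> //.
apply/entails_setP => //; split=> //.
by apply/stype_slice/(typedef_stype _ tD)/small_sum.
Qed.

(** The sets implied by [f_* Pi] have their inverse images implied by [Pi]: a small
    part of [f_* Pi] comes from small partial types on [Q], whose invariance makes the
    choice of the representative of [f(a)] immaterial. *)
Lemma filt_push (P Q : quot M) (f : (ix P -> M) -> (ix Q -> M) -> Prop)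
    (Pi : set (pformula M (ix P))) (D : set (ix Q -> M)) :
  (forall a b b', f a b -> f a b' -> eqv Q b b') ->
  filt Pi [set a | exists b, f a b] -> filt (push kappa f Pi) D ->
  filt Pi [set a | exists b, f a b /\ D b].
Proof.
move=> funf deff [Pi0 [sPi0 sub PiD]].
have : filt Pi [set a | forall u : {phi | Pi0 phi},
    exists b, f a b /\ forall b', eqv Q b b' -> psat b' (proj1_sig u)].
  apply: filt_bigcap => [|[phi Pi0phi]]; first exact: small_sig.
  have [G [[_ Gon] /entails_filt + Gphi]] := sub _ Pi0phi.
  apply: filtS => a [b [fab Gb]]; exists b; split=> //= b' bb'.
  by apply: (Gon.2 b b').
move=> /(filt_setI deff); apply: filtS => a [[b fab] h]; exists b; split=> //.
apply: PiD => phi Pi0phi; have [b' [fab' /=]] := h (exist _ phi Pi0phi).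
by apply; apply: funf fab' fab.
Qed.

Lemma push_filt (P Q : quot M) (f : (ix P -> M) -> (ix Q -> M) -> Prop)
    (Pi : set (pformula M (ix P))) (D : set (ix Q -> M)) :
  small kappa [set: ix P] -> stype D -> subset_on D ->
  stype [set a | exists b, f a b /\ D b] ->
  filt Pi [set a | exists b, f a b /\ D b] -> filt (push kappa f Pi) D.
Proof.
move=> sP [G sG <-] Gon sfG PifG; exists G; split=> // phi Gphi.
by exists G; split=> //; apply/entails_setP.
Qed.

(** Both filters being closed under small intersections, the conditions that define a
    small part of [Pi (x) Rho] can be met at once, first in [b] and then in [a]. *)
Lemma filt_tensor (P Q : quot M) (Pi : set (pformula M (ix P)))
    (Rho : set (pformula M (ix Q))) (D : set (ix (quot_prod P Q) -> M)) :
  filt (tensor kappa Pi Rho) D ->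
  filt Pi [set a | filt Rho [set b | D (join a b)]].
Proof.
move=> [G [sG sub GD]].
have : filt Pi [set a | forall u : {phi | G phi},
    filt Rho [set b | psat (join a b) (proj1_sig u)]].
  apply: filt_bigcap => [|[phi Gphi]]; first exact: small_sig.
  have [G' [_ /entails_filt + G'phi]] := sub _ Gphi.
  apply: filtS => a [_ /entails_filt]; apply: filtS => b; exact.
apply: filtS => a /(filt_bigcap (small_sig sG)); apply: filtS => b h.
by apply: GD => phi Gphi; apply: (h (exist _ phi Gphi)).
Qed.

(** The converse needs the inner condition on [a] to be type-definable, which
    definability of [Rho] provides in the applications. *)
Lemma tensor_entails (P Q : quot M) (Pi : set (pformula M (ix P)))
    (Rho : set (pformula M (ix Q))) (D : set (ix (quot_prod P Q) -> M)) :
  small kappa [set: ix P] -> small kappa [set: ix Q] ->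
  stype D -> subset_on D ->
  stype [set a | dom P a /\ filt Rho [set b | D (join a b)]] ->
  filt Pi [set a | dom P a /\ filt Rho [set b | D (join a b)]] ->
  entails_set kappa (tensor kappa Pi Rho) D.
Proof.
move=> sP sQ sD Don sD' PiD.
apply/entails_setP; first exact: small_sum.
split=> //; case: sD => G sG GD; rewrite -{}GD in Don sD' PiD *.
exists G; split=> // phi Gphi; exists G; split=> //.
have E :
    [set a | dom P a /\ entails_set kappa Rho [set b | realizations G (join a b)]] =
    [set a | dom P a /\ filt Rho [set b | realizations G (join a b)]].
  apply/seteqP; split=> a /= [adom ent]; split=> //; first exact: entails_filt.
  by apply/entails_setP => //; split=> //; apply: stype_slicel; exists G.
by rewrite E; apply/entails_setP.
Qed.

(** The formulas of [Pi] come in small partial types on [P], so that members of the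
    filter can be shrunk to invariant ones. *)
Lemma filt_shrink (P : quot M) (Pi : set (pformula M (ix P))) (D : set (ix P -> M)) :
  (forall a b, eqv P a b -> dom P b) -> partial_type_on kappa Pi -> filt Pi D ->
  exists D', [/\ D' `<=` D, filt Pi D', stype D' & subset_on D'].
Proof.
move=> eqdom [Pidom Pion] [Pi0 [sPi0 sub PiD]].
have /choice[G GE] (u : {phi | Pi0 phi}) : exists Gamma : set (pformula M (ix P)),
    [/\ small_type_on kappa Gamma, Gamma `<=` Pi & Gamma (proj1_sig u)].
  by case: u => phi phi0; apply/Pion/sub.
exists [set a | dom P a /\ forall u, realizations (G u) a]; split.
- move=> a [_ aG]; apply: PiD => phi Pi0phi.
  by apply: (aG (exist _ phi Pi0phi)); have [] := GE (exist _ phi Pi0phi).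
- apply: filt_setI; first exact: entails_filt.
  apply: filt_bigcap => [|u]; first exact: small_sig.
  by have [[sG _] GPi _] := GE u; exists (G u); split.
- apply: stype_setI; first by case: Pidom => Gd [? <- _]; exists Gd.
  apply: stype_bigcap => [|u]; first exact: small_sig.
  by have [[sG _] _ _] := GE u; exists (G u).
- split=> [a []//|a b ab [_ aG]]; split; first exact: eqdom ab.
  by move=> u; have [[_ Gon] _ _] := GE u; apply: Gon.2 (aG u).
Qed.

End TypeDefinable.

(** * Germs of partial bijections and their fractions *)

Section Germs.
Variables (T : Type) (E : T -> T -> Prop) (Q : set (set T)).
Hypotheses (E_sym : forall x y, E x y -> E y x)
  (E_trans : forall x y z, E x y -> E y z -> E x z).
Hypotheses (QS : forall A B : set T, A `<=` B -> Q A -> Q B)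
  (QI : forall A B : set T, Q A -> Q B -> Q [set x | A x /\ B x])
  (QE : Q [set x | E x x]).

Definition rinv (r : T -> T -> Prop) : T -> T -> Prop := fun x y => r y x.

Definition rcomp (r s : T -> T -> Prop) : T -> T -> Prop :=
  fun x y => exists z, s x z /\ r z y.

(** Graphs of the partial bijections of [T / E] along which [Q] is invariant, in
    both directions. *)
Record preserving (r : T -> T -> Prop) : Prop := {
  pres_inv : forall x y x' y', r x y -> E x x' -> E y y' -> r x' y';
  pres_dom : forall x y, r x y -> E x x /\ E y y;
  pres_fun : forall x y y', r x y -> r x y' -> E y y';
  pres_inj : forall x x' y, r x y -> r x' y -> E x x';
  pres_image : forall D, Q D -> Q [set y | exists x, D x /\ r x y];
  pres_preim : forall D, Q D -> Q [set x | exists y, D y /\ r x y] }.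

Definition germ_eq (r s : T -> T -> Prop) : Prop :=
  Q [set x | exists y, r x y /\ s x y].

(** What remains of [preserving] for translations by arbitrary elements, which occur
    in type-definable families of translations. *)
Definition rel_on (r : T -> T -> Prop) : Prop :=
  (forall x y x' y', r x y -> E x x' -> E y y' -> r x' y') /\
  (forall x y, r x y -> E x x /\ E y y).

Lemma rel_on_rinv r : rel_on r -> rel_on (rinv r).
Proof.
move=> [inv dom]; split=> [x y x' y' xy xx' yy'|x y /dom[]//].
exact: inv xy yy' xx'.
Qed.

Lemma rel_on_rcomp r s : rel_on r -> rel_on s -> rel_on (rcomp r s).
Proof.
move=> [ri rd] [si sd]; split=> [x y x' y' [z [xz zy]] xx' yy'|].
  exists z; have [_ zz] := sd _ _ xz.
  by split; [apply: si xz xx' zz|apply: ri zy zz yy'].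
by move=> x y [z [/sd[] ? _ /rd[]]].
Qed.

Lemma pres_E : preserving E.
Proof.
split=> [x y x' y' xy xx' yy'|x y xy|x y y' xy|x x' y xy x'y|D QD|D QD].
- exact: E_trans (E_sym xx') (E_trans xy yy').
- by split; apply: E_trans; eauto.
- exact/E_trans/E_sym.
- exact: E_trans xy (E_sym x'y).
- by apply: QS (QI QD QE) => x [Dx xx]; exists x.
- by apply: QS (QI QD QE) => x [Dx xx]; exists x.
Qed.

Lemma pres_rinv r : preserving r -> preserving (rinv r).
Proof.
case=> inv dom func inj im pre; split=> //.
- by move=> x y x' y' xy xx' yy'; apply: inv xy yy' xx'.
- by move=> x y /dom[].
- by move=> x y y'; apply: inj.
- by move=> x x' y; apply: func.
Qed.

Lemma pres_rcomp r s : preserving r -> preserving s -> preserving (rcomp r s).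
Proof.
move=> [ri rd rf rj rim rpre] [si sd sf sj sim spre]; split.
- move=> x y x' y' [z [xz zy]] xx' yy'; exists z.
  have [_ zz] := sd _ _ xz.
  by split; [apply: si xz xx' zz|apply: ri zy zz yy'].
- by move=> x y [z [/sd[] ? _ /rd[]]].
- move=> x y y' [z [xz zy]] [z' [xz' zy']].
  have zz' := sf _ _ _ xz xz'; have [_ yy] := rd _ _ zy.
  exact: rf (ri _ _ _ _ zy zz' yy) zy'.
- move=> x x' y [z [xz zy]] [z' [xz' zy']].
  have zz' := rj _ _ _ zy zy'; have [xx _] := sd _ _ xz.
  exact: sj (si _ _ _ _ xz xx zz') xz'.
- move=> D /sim/rim; apply: QS => y [z [[x [Dx xz]] zy]].
  by exists x; split=> //; exists z.
- move=> D /rpre/spre; apply: QS => x [z [[y [Dy zy]] xz]].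
  by exists y; split=> //; exists z.
Qed.

Lemma rcompA r s t : rcomp r (rcomp s t) = rcomp (rcomp r s) t.
Proof.
apply: funext => x; apply: funext => y; apply/propext; split.
  by move=> [z [[w [xw wz]] zy]]; exists w; split=> //; exists z.
by move=> [w [xw [z [wz zy]]]]; exists z; split=> //; exists w.
Qed.

Lemma rinv_rcomp r s : rinv (rcomp r s) = rcomp (rinv s) (rinv r).
Proof.
apply: funext => x; apply: funext => y; apply/propext.
by split=> -[z [? ?]]; exists z.
Qed.

Lemma rcompE r : preserving r -> rcomp r E = r.
Proof.
move=> pr; apply: funext => x; apply: funext => y; apply/propext; split.
  move=> [z [xz zy]]; have [_ yy] := pres_dom pr zy.
  exact: (pres_inv pr zy (E_sym xz) yy).
by move=> xy; exists x; split=> //; have [] := pres_dom pr xy.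
Qed.

Lemma rcompEl r : preserving r -> rcomp E r = r.
Proof.
move=> pr; apply: funext => x; apply: funext => y; apply/propext; split.
  move=> [z [xz zy]]; have [xx _] := pres_dom pr xz.
  exact: (pres_inv pr xz xx zy).
by move=> xy; exists y; split=> //; have [] := pres_dom pr xy.
Qed.

Lemma germ_refl r : preserving r -> germ_eq r r.
Proof.
by move=> pr; apply: QS (pres_preim pr QE) => x [y [_ xy]]; exists y.
Qed.

Lemma germ_sym r s : germ_eq r s -> germ_eq s r.
Proof. by apply: QS => x [y [xy xy']]; exists y. Qed.

Lemma germ_trans s r t : preserving s -> preserving t ->
  germ_eq r s -> germ_eq s t -> germ_eq r t.
Proof.
move=> ps pt rs st; apply: QS (QI rs st) => x [[y [rxy sxy]] [y' [sxy' txy']]].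
exists y; split=> //; have [xx _] := pres_dom ps sxy.
exact: (pres_inv pt txy' xx (pres_fun ps sxy' sxy)).
Qed.

(** Agreement at generic [x] becomes agreement at the image of [x], which is generic
    again. *)
Lemma germ_rinv r s : preserving r -> preserving s ->
  germ_eq r s -> germ_eq (rinv r) (rinv s).
Proof.
move=> pr ps /(pres_image pr); apply: QS => y [x [[y' [rxy' sxy']] rxy]].
exists x; split=> //; have [xx _] := pres_dom ps sxy'.
exact: (pres_inv ps sxy' xx (pres_fun pr rxy' rxy)).
Qed.

Lemma germ_rcomp r r' s s' : preserving r -> preserving r' -> preserving s ->
  germ_eq r r' -> germ_eq s s' -> germ_eq (rcomp r s) (rcomp r' s').
Proof.
move=> pr pr' ps rr' ss'.
apply: QS (QI (pres_preim ps rr') ss').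
move=> x [[z [[y [rzy r'zy]] sxz]] [z' [sxz' s'xz']]].
have [zz yy] := pres_dom pr rzy.
exists y; split; first by exists z.
by exists z'; split=> //; apply: pres_inv r'zy (pres_fun ps sxz sxz') yy.
Qed.

Lemma germ_rinvK r : preserving r -> germ_eq (rcomp r (rinv r)) E.
Proof.
move=> pr; apply: QS (pres_image pr QE) => y [x [_ xy]].
by exists y; split; [exists x|have [] := pres_dom pr xy].
Qed.

Lemma germ_rinvKl r : preserving r -> germ_eq (rcomp (rinv r) r) E.
Proof. by move=> pr; apply: (germ_rinvK (pres_rinv pr)). Qed.

Section Chunk.
Variables (A : set T) (F : T -> T -> T -> Prop).
Hypotheses (Q_proper : forall D, Q D -> D !=set0) (QA : Q A)
  (A_inv : forall a b, E a b -> A a -> A b).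
Hypotheses (F_pres : forall a, A a -> preserving (F a))
  (F_inv : forall a b x y, E a b -> F a x y -> F b x y)
  (F_cancel : forall a b x y, F a x y -> F b x y -> E a b).

(** The points generic enough over [a] for associativity: [F_a F_b = F_(a b)] holds
    on germs. *)
Definition mult (a : T) : set T :=
  [set b | exists c, [/\ F a b c, A b, A c & germ_eq (rcomp (F a) (F b)) (F c)]].

Hypothesis Q_mult : forall a, A a -> Q (mult a).

Definition frac (a b : T) : T -> T -> Prop := rcomp (F a) (rinv (F b)).

Lemma F_eq a b : E a b -> F a = F b.
Proof.
move=> ab; apply: funext => x; apply: funext => y; apply/propext.
by split; apply: F_inv => //; apply: E_sym.
Qed.

Lemma mult_germ a b c : A a -> mult a b -> F a b c ->
  [/\ A b, A c & germ_eq (rcomp (F a) (F b)) (F c)].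
Proof.
move=> Aa [c' [abc' Ab Ac' gc']] abc.
have c'c := pres_fun (F_pres Aa) abc' abc.
by rewrite -(F_eq c'c); split=> //; apply: A_inv Ac'.
Qed.

Lemma pres_frac a b : A a -> A b -> preserving (frac a b).
Proof.
by move=> Aa Ab; apply: pres_rcomp; [|apply: pres_rinv]; apply: F_pres.
Qed.
Hint Resolve pres_frac pres_rcomp pres_rinv F_pres pres_E germ_refl : core.

(** The left quotient [F_a^-1 F_b] is a right fraction.  The translates by [a] and
    by [b] of a set in the filter meet, so [a e' = b e] for generic [e], [e']; hence
    [F_a F_e' = F_b F_e] and [F_a^-1 F_b = F_e' F_e^-1]. *)
Lemma left_frac a b D : A a -> A b -> Q D ->
  exists e e', [/\ A e, A e', D e, D e' &
    germ_eq (rcomp (rinv (F a)) (F b)) (frac e' e)].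
Proof.
move=> Aa Ab QD.
have QDa := pres_image (F_pres Aa) (QI QD (Q_mult Aa)).
have QDb := pres_image (F_pres Ab) (QI QD (Q_mult Ab)).
(* [y] is the common value [a e' = b e]. *)
have [y [[e' [[De' ae'] ae'y]] [e [[De be] bey]]]] := Q_proper (QI QDa QDb).
exists e, e'.
have [Ae' Ay ge'] := mult_germ Aa ae' ae'y.
have [Ae _ ge] := mult_germ Ab be bey.
split=> //.
have g : germ_eq (rcomp (F b) (F e)) (rcomp (F a) (F e')).
  by apply: germ_trans ge (germ_sym ge'); auto.
have {g} : germ_eq (rcomp (rinv (F a)) (rcomp (rcomp (F b) (F e)) (rinv (F e))))
    (rcomp (rinv (F a)) (rcomp (rcomp (F a) (F e')) (rinv (F e)))).
  by do 2 ?apply: germ_rcomp; auto 7.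
rewrite -[rcomp (rcomp (F b) _) _]rcompA rcompA.
have h1 : germ_eq (rcomp (rinv (F a)) (F b))
   (rcomp (rcomp (rinv (F a)) (F b)) (rcomp (F e) (rinv (F e)))).
  rewrite -{1}[rcomp _ (F b)]rcompE; last by auto.
  by apply: germ_rcomp; auto; apply: germ_sym; apply: germ_rinvK; auto.
move=> h2; apply: germ_trans h1 _; [by auto 7|by auto|].
apply: germ_trans h2 _; [by auto 8|by auto|].
rewrite -rcompA rcompA -[X in germ_eq _ X]rcompEl; last by auto.
by apply: germ_rcomp; auto; apply: germ_rinvKl; auto.
Qed.

(** In [F_a F_b^-1 F_c F_d^-1] rewrite [F_b^-1 F_c] as [F_e' F_e^-1] with [e'] generic
    over [a] and [e] generic over [d]; the product is [F_(a e') F_(d e)^-1]. *)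
Lemma frac_mul a b c d : A a -> A b -> A c -> A d ->
  exists p q, [/\ A p, A q & germ_eq (rcomp (frac a b) (frac c d)) (frac p q)].
Proof.
move=> Aa Ab Ac Ad.
have [e [e' [Ae Ae' [_ de] [ae' _] g]]] :=
  left_frac Ab Ac (QI (Q_mult Aa) (Q_mult Ad)).
have [p [ae'p _ Ap gp]] := ae'; have [q [deq _ Aq gq]] := de.
exists p, q; split=> //.
have {g} : germ_eq (rcomp (F a) (rcomp (rcomp (rinv (F b)) (F c)) (rinv (F d))))
    (rcomp (F a) (rcomp (frac e' e) (rinv (F d)))).
  by do 2 ?apply: germ_rcomp; auto 7.
rewrite /frac -!rcompA => g; apply: germ_trans g _; [by auto 9|by auto|].
rewrite -rinv_rcomp rcompA.
by apply: germ_rcomp; auto; apply: germ_rinv; auto.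
Qed.

(** [F_a = F_(a q) F_q^-1] for generic [q]. *)
Lemma F_frac a : A a -> exists p q, [/\ A p, A q & germ_eq (F a) (frac p q)].
Proof.
move=> Aa; have [q [p [_ Aq Ap g]]] := Q_proper (Q_mult Aa).
exists p, q; split=> //.
apply: (@germ_trans (rcomp (rcomp (F a) (F q)) (rinv (F q)))).
- by auto 7.
- by auto.
- rewrite -rcompA -{1}[F a]rcompE; last by auto.
  by apply: germ_rcomp; auto; apply/germ_sym/germ_rinvK; auto.
- by apply: germ_rcomp; auto.
Qed.

Lemma F_germ_inj a b : A a -> A b -> germ_eq (F a) (F b) -> E a b.
Proof. by move=> Aa Ab /Q_proper[x [y [axy bxy]]]; apply: F_cancel axy bxy. Qed.

Lemma frac_rinv a b : rinv (frac a b) = frac b a.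
Proof. exact: rinv_rcomp. Qed.

Lemma frac_id a : A a -> germ_eq (frac a a) E.
Proof. by move=> Aa; apply: germ_rinvK; auto. Qed.

(** A fraction [g = F_c F_d^-1] moves a generic [a] to some [a'] with
    [F_a' = g F_a]: write [a = d x], so that [a' = c x] and
    [F_a' = F_c F_x = F_c F_d^-1 F_a]. *)
Lemma frac_equivariant c d : A c -> A d ->
  Q [set a | exists a', [/\ frac c d a a', A a, A a' &
    germ_eq (F a') (rcomp (frac c d) (F a))]].
Proof.
move=> Ac Ad.
apply: QS (pres_image (F_pres Ad) (QI (Q_mult Ad) (Q_mult Ac))).
move=> y [x [[dx cx] dxy]].
have [Ax Ay gy] := mult_germ Ad dx dxy.
have [z [cxz _ Az gz]] := cx.
exists z; split=> //; first by exists x.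
apply: (germ_trans _ _ (germ_sym gz)); [by auto|by auto|].
rewrite /frac -rcompA; apply: germ_rcomp; auto.
apply: (@germ_trans (rcomp (rinv (F d)) (rcomp (F d) (F x)))); auto 7.
  rewrite rcompA -{1}[F x]rcompEl; last by auto.
  by apply: germ_rcomp; auto; apply/germ_sym/germ_rinvKl; auto.
by apply: germ_rcomp; auto.
Qed.

End Chunk.
End Germs.

(** * Type-definable families of relations *)

Section Relations.
Variables (L : language) (T : set (sentence L)) (kappa : Type) (M : structure L).
Hypothesis hM : monster M T kappa.
Variables (C : heqset kappa M) (P : quot M).
Hypothesis sP : small kappa [set: ix P].

Let small_add := small_sum (monster_uncountable hM) (monster_regular hM).

Lemma typedef_ex (I J : Type) (D : (I -> M) -> (J -> M) -> Prop) :
  small kappa [set: I] -> small kappa [set: J] ->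
  typedef C [set c : I + J -> M | D (c \o inl) (c \o inr)] ->
  typedef C [set a | exists z, D a z].
Proof. by move=> sI sJ /(typedef_exists hM sI sJ). Qed.

(** Type-definability over [C] of a family of binary relations, uniformly in the
    [I]-tuple that indexes it. *)
Definition tdrel (I : Type) (r : (I -> M) -> (ix P -> M) -> (ix P -> M) -> Prop) :
    Prop :=
  typedef C [set c : I + ix P + ix P -> M |
    r (c \o inl \o inl) (c \o inl \o inr) (c \o inr)].

Lemma tdrel_at (I J : Type) r (f : I -> J) (g h : ix P -> J) : tdrel r ->
  typedef C [set c : J -> M | r (c \o f) (c \o g) (c \o h)].
Proof. exact: (typedef_preim (join (join f g) h)). Qed.

Lemma tdrel_reindex (I J : Type) r (f : I -> J) : tdrel r ->
  tdrel (fun c => r (c \o f)).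
Proof. exact: (tdrel_at (inl \o inl \o f)). Qed.

Lemma tdrel_rinv (I : Type) (r : (I -> M) -> (ix P -> M) -> (ix P -> M) -> Prop) :
  tdrel r -> tdrel (fun c => rinv (r c)).
Proof. exact: (tdrel_at (inl \o inl) inr (inl \o inr)). Qed.

Lemma tdrel_rcomp (I : Type) r s : small kappa [set: I] ->
  @tdrel I r -> @tdrel I s -> tdrel (fun c => rcomp (r c) (s c)).
Proof.
move=> sI grp_germ ts; apply: typedef_ex => //; first by do 2 ?apply: small_add.
apply: typedef_setI.
  exact: (tdrel_at (inl \o (inl \o inl)) (inl \o (inl \o inr)) inr ts).
exact: (tdrel_at (inl \o (inl \o inl)) inr (inl \o inr) grp_germ).
Qed.

Lemma tdrel_graph (F : (ix (quot_prod P P) -> M) -> (ix P -> M) -> Prop) :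
  typedef C (rel_set F) -> tdrel (fun a b c => F (join a b) c).
Proof.
rewrite /tdrel; congr typedef; apply/seteqP.
by split=> c /=; rewrite /rel_set /= join_eta.
Qed.

Lemma tdrel_stype (I : Type) r (a : I -> M) : small kappa [set: I] -> tdrel r ->
  stype kappa [set c : ix P + ix P -> M | r a (c \o inl) (c \o inr)].
Proof.
move=> sI; have sIPP : small kappa [set: I + ix P + ix P] by do 2 ?apply: small_add.
move=> /(typedef_stype hM sIPP) sr.
exact: (stype_subst (fun u : I + ix P + ix P => match u with
  | inl (inl i) => inr (a i)
  | inl (inr p) => inl (inl p)
  | inr p => inl (inr p) end) sr).
Qed.

Lemma stype_ex (I J : Type) (D : (I -> M) -> (J -> M) -> Prop) :
  small kappa [set: J] ->
  stype kappa [set c : I + J -> M | D (c \o inl) (c \o inr)] ->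
  stype kappa [set a | exists z, D a z].
Proof. by move=> sJ /(stype_exists hM sJ). Qed.

Variable Pi : set (pformula M (ix P)).
Hypothesis defPi : type_definable C Pi.
Hypothesis eqdom : forall a b, eqv P a b -> dom P a /\ dom P b.

(** Equality of germs is one application of the quantifier that definability of [Pi]
    gives. *)
Lemma typedef_germ_eq (I : Type)
    (r s : (I -> M) -> (ix P -> M) -> (ix P -> M) -> Prop) :
  small kappa [set: I] -> tdrel r -> tdrel s ->
  (forall c, rel_on (eqv P) (r c)) -> (forall c, rel_on (eqv P) (s c)) ->
  typedef C [set c | germ_eq (filt kappa Pi) (r c) (s c)].
Proof.
move=> sI grp_germ ts ron son.
apply: (@typedef_filt _ _ _ _ hM C P Pi I (fun c => exists y,
  r (c \o inr) (c \o inl) y /\ s (c \o inr) (c \o inl) y)) => //.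
  apply: typedef_ex => //; first exact: small_add.
  apply: typedef_setI.
    exact: (tdrel_at (inl \o inr) (inl \o inl) inr grp_germ).
  exact: (tdrel_at (inl \o inr) (inl \o inl) inr ts).
move=> c; split=> [x [y [rxy _]]|x x' xx' [y [rxy sxy]]].
  by have [/eqdom[]] := (ron c).2 _ _ rxy.
have [_ yy] := (ron c).2 _ _ rxy.
by exists y; split; [apply: (ron c).1 rxy xx' yy|apply: (son c).1 sxy xx' yy].
Qed.

End Relations.

(** * Generic elements of hyperdefinable sets *)

Section HyperdefinableSets.
Variables (L : language) (T : set (sentence L)) (kappa : Type) (M : structure L).
Hypothesis hM : monster M T kappa.
Variables (C : heqset kappa M) (P : quot M).
Hypothesis hP : hyperdefinable C P.

Let small_add := small_sum (monster_uncountable hM) (monster_regular hM).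

Lemma hyperdefinable_small : small kappa [set: ix P].
Proof. by case: hP. Qed.
Let sP := hyperdefinable_small.

Lemma hyperdefinable_dom a b : eqv P a b -> dom P a /\ dom P b.
Proof. by have [_ [_ [_ [_ [h _]]]]] := hP; apply: h. Qed.
Let eqdom := hyperdefinable_dom.

Lemma hyperdefinable_refl a : dom P a -> eqv P a a.
Proof. by have [_ [_ [_ [_ [_ [h _]]]]]] := hP; apply: h. Qed.
Let eqrefl := hyperdefinable_refl.

Lemma hyperdefinable_sym a b : eqv P a b -> eqv P b a.
Proof. by have [_ [_ [_ [_ [_ [_ [h _]]]]]]] := hP; apply: h. Qed.
Let eqsym := hyperdefinable_sym.

Lemma hyperdefinable_trans a b c : eqv P a b -> eqv P b c -> eqv P a c.
Proof. by have [_ [_ [_ [_ [_ [_ [_ h]]]]]]] := hP; apply: h. Qed.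
Let eqtrans := hyperdefinable_trans.

Lemma typedef_dom : typedef C (dom P).
Proof. by case: hP => _ [_ []]. Qed.

Section TypeOnP.
Variable Pi : set (pformula M (ix P)).
Hypotheses (PiP : partial_type_on kappa Pi) (defPi : type_definable C Pi).

Let Q := filt kappa Pi.
Let R := restr C Pi.

Lemma filt_dom : Q (dom P).
Proof. exact (entails_filt hM PiP.1). Qed.

Lemma filt_restr : Q R.
Proof. exact: (restr_filt hM hP filt_dom). Qed.

(** To prove something of every realization of [Pi|_C] it is enough to prove it
    generically, provided that it is [C]-type-definable. *)
Lemma restr_min (D : set (ix P -> M)) : typedef C D ->
  (forall a b, eqv P a b -> D a -> D b) -> Q D -> R `<=` D.
Proof.
move=> tD Dinv QD a [adom aR].
have [] := aR [set x | dom P x /\ D x]; last by [].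
- by split=> [x []//|x y xy [_ Dx]]; split; [case: (eqdom xy)|apply: Dinv xy Dx].
- exact: typedef_setI typedef_dom tD.
- apply/(entails_setP hM) => //; split; last exact: (filt_setI hM filt_dom QD).
  by apply: (typedef_stype hM) => //; apply: typedef_setI typedef_dom tD.
Qed.

Lemma restr_inv a b : eqv P a b -> R a -> R b.
Proof. by move=> ab; apply: (restr_subset_on hP Pi).2 ab. Qed.

(** [Pi] concentrates on its sort, so the fibres of [D] can be cut down to the sort
    before definability of [Pi] is applied. *)
Lemma typedef_generic (I : Type) (D : set (I + ix P -> M)) :
  small kappa [set: I] -> typedef C D ->
  (forall b x y, eqv P x y -> D (join b x) -> D (join b y)) ->
  typedef C [set b | Q [set x | D (join b x)]].
Proof.
move=> sI tD Dinv.
pose D' := [set c : ix P + I -> M | dom P (c \o inl) /\ D (c \o join inr inl)].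
have joinE (x : ix P -> M) (b : I -> M) : join x b \o join inr inl = join b x.
  exact: comp_join.
have := typedef_filt hM (D := D') defPi sP sI.
rewrite (_ : [set b | filt _ _ _] = [set b | Q [set x | D (join b x)]]).
  apply; first by apply: typedef_setI; apply: typedef_preim => //; exact: typedef_dom.
  move=> b; split=> [x []//|x y xy [_]]; rewrite /D' /= !joinE => /(Dinv _ _ _ xy) Dby.
  by split=> //; case: (eqdom xy).
apply/seteqP; split=> b /=.
  by apply: filtS => x [_]; rewrite joinE.
move=> /(filt_setI hM filt_dom); apply: filtS => x [xd Dbx].
by split=> //; rewrite joinE.
Qed.

End TypeOnP.

Lemma hyperdefinable_prod (P' : quot M) : hyperdefinable C P' ->
  hyperdefinable C (quot_prod P P').
Proof.
move=> [s' [[y y'] [td' [te' [ed' [er' [es' et']]]]]]].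
have [s [[x xd] [td [te _]]]] := hP.
split; first exact: small_add.
split; first by exists (join x y).
split; first by apply: typedef_setI; apply: typedef_preim.
split.
  apply: typedef_setI.
    exact: (typedef_preim (join (inl \o inl) (inr \o inl) :
      ix P + ix P -> (ix P + ix P') + (ix P + ix P')) te).
  exact: (typedef_preim (join (inl \o inr) (inr \o inr) :
      ix P' + ix P' -> (ix P + ix P') + (ix P + ix P')) te').
split; first by move=> a b [/eqdom[? ?] /ed'[? ?]].
split; first by move=> a [/eqrefl ? /er' ?].
split; first by move=> a b [/eqsym ? /es' ?].
by move=> a b c [ab ab'] [bc bc']; split; [apply: eqtrans ab bc|apply: et' ab' bc'].
Qed.

Lemma filt_tensor_dom (P' : quot M) (Pi : set (pformula M (ix P)))
    (Rho : set (pformula M (ix P'))) : hyperdefinable C P' ->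
  filt kappa Pi (dom P) -> filt kappa Rho (dom P') ->
  filt kappa (tensor kappa Pi Rho) (dom (quot_prod P P')).
Proof.
move=> hP' Pid Rhod; have [s' _] := hP'.
have [sPP [_ [tPP [_ [eqPP _]]]]] := hyperdefinable_prod hP'.
have E : [set a | dom P a /\ filt kappa Rho [set b | dom (quot_prod P P') (join a b)]]
    = dom P.
  apply/seteqP; split=> [a []//|a adom]; split=> //.
  by apply: filtS Rhod => b b'; split.
apply: (entails_filt hM); apply: (tensor_entails hM) => //; rewrite ?E //.
- exact: (typedef_stype hM sPP tPP).
- by split=> [a //|a b /eqPP[]].
- exact: (typedef_stype hM sP typedef_dom).
Qed.

End HyperdefinableSets.

(** * The translations of a group chunk *)

Section Translations.
Variables (L : language) (T : set (sentence L)) (kappa : Type) (M : structure L).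
Hypothesis hM : monster M T kappa.
Variables (C : heqset kappa M) (P : quot M).
Hypothesis hP : hyperdefinable C P.
Variables (Pi : set (pformula M (ix P)))
  (F H K : (ix (quot_prod P P) -> M) -> (ix P -> M) -> Prop).
Hypothesis hchunk : group_chunk C Pi F H K.

Let small_add := small_sum (monster_uncountable hM) (monster_regular hM).
Let sP := hyperdefinable_small hP.
Let eqdom := hyperdefinable_dom hP.
Let eqrefl := hyperdefinable_refl hP.
Let eqsym := hyperdefinable_sym hP.
Let eqtrans := hyperdefinable_trans hP.
Let PiP := gc_type hchunk.
Let defPi := gc_def hchunk.
Let E := eqv P.
Let Q := filt kappa Pi.
Let R := restr C Pi.
Let QS := @filtS L kappa M (ix P) Pi.
Let QI := @filt_setI L T kappa M hM (ix P) Pi.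
Let Qdom : Q (dom P) := filt_dom hM PiP.
Let QR : Q R := filt_restr hM hP PiP.

Lemma filt_eqv_refl : Q [set x | E x x].
Proof. by apply: QS Qdom => x /eqrefl. Qed.

(** The set of those [a] over which [D(a, b)] holds for generic [b] is
    [C]-type-definable, so it contains all of [Pi|_C] once it is in the filter. *)
Lemma restr_generic (D : set (ix P + ix P -> M)) : typedef C D ->
  (forall b x y, eqv P x y -> D (join b x) -> D (join b y)) ->
  (forall b x y, eqv P x y -> D (join x b) -> D (join y b)) ->
  Q [set a | Q [set b | D (join a b)]] -> forall a, R a -> Q [set b | D (join a b)].
Proof.
move=> tD Dinv Dinv' QD.
apply: (restr_min hM hP PiP (D := [set a | Q [set b | D (join a b)]])) => //.
  exact: (typedef_generic hM hP PiP).
by move=> x y xy; apply: QS => b; apply: Dinv'.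
Qed.

(** The square of [Pi] implies its own restriction to [C], so [D(a, b)] holds for
    generic [b] over generic [a]; [restr_generic] improves the latter. *)
Lemma restr_tensor2 (D : set (ix (quot_prod P P) -> M)) :
  restr C (P := quot_prod P P) (tensor kappa Pi Pi) `<=` D ->
  forall a, R a -> Q [set b | D (join a b)].
Proof.
move=> RD a Ra.
have hPP := hyperdefinable_prod hM hP hP.
have [Rdom Rinv] := restr_subset_on hPP (tensor kappa Pi Pi).
apply: (@QS [set b | restr C (P := quot_prod P P) (tensor kappa Pi Pi) (join a b)]).
  by move=> b /RD.
apply: (restr_generic (D := restr C (P := quot_prod P P) (tensor kappa Pi Pi))) => //.
- exact: (restr_typedef hPP).
- move=> b x y xy Rbx; apply: Rinv (Rbx); split=> //=.
  by have /Rdom[/eqrefl] := Rbx.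
- move=> b x y xy Rbx; apply: Rinv (Rbx); split=> //=.
  by have /Rdom[_ /eqrefl] := Rbx.
- apply: (filt_tensor hM); apply: (restr_filt hM hPP).
  exact: (filt_tensor_dom hM hP hP).
Qed.

(** As for pairs, with one more application of the generic quantifier. *)
Lemma restr_tensor3 (D : set (ix (quot_prod P (quot_prod P P)) -> M)) :
  restr C (P := quot_prod P (quot_prod P P)) (tensor kappa Pi (tensor kappa Pi Pi))
    `<=` D ->
  forall a, R a -> Q [set b | Q [set c | D (join a (join b c))]].
Proof.
move=> RD a Ra.
have hPP := hyperdefinable_prod hM hP hP.
have hPPP := hyperdefinable_prod hM hP hPP.
pose R3 := restr C (P := quot_prod P (quot_prod P P))
  (tensor kappa Pi (tensor kappa Pi Pi)).
have [R3dom R3inv] : subset_on R3 := restr_subset_on hPPP _.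
have R3E x y z x' y' z' : E x x' -> E y y' -> E z z' ->
  R3 (join x (join y z)) -> R3 (join x' (join y' z')).
  by move=> xx' yy' zz'; apply: R3inv; split=> //; split.
have R3refl x y z : R3 (join x (join y z)) -> [/\ E x x, E y y & E z z].
  by move=> /R3dom[/eqrefl xx [/eqrefl yy /eqrefl zz]].
pose assoc : ix P + (ix P + ix P) -> ix P + ix P + ix P :=
  join (inl \o inl) (join (inl \o inr) inr).
have assocE (u : ix P + ix P -> M) (z : ix P -> M) :
    join u z \o assoc = join (u \o inl) (join (u \o inr) z).
  by rewrite /assoc !comp_join.
pose D2 := [set u : ix P + ix P -> M | Q [set z | R3 (join u z \o assoc)]].
have tD2 : typedef C D2.
  have := typedef_generic hM hP PiP defPi
    (D := [set v : ix P + ix P + ix P -> M | R3 (v \o assoc)]).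
  apply=> [||b x y xy /=].
  - exact: small_add.
  - exact/typedef_preim/(restr_typedef hPPP).
  - rewrite !assocE => R3b.
    by have [? ? _] := R3refl _ _ _ R3b; apply: R3E R3b.
apply: (@QS [set b | D2 (join a b)]).
  by move=> b; apply: QS => c /=; rewrite assocE => /RD.
apply: restr_generic => //.
- move=> b x y xy; apply: QS => z /=; rewrite !assocE => R3b.
  by have [? ? ?] := R3refl _ _ _ R3b; apply: R3E R3b.
- move=> b x y xy; apply: QS => z /=; rewrite !assocE => R3b.
  by have [? ? ?] := R3refl _ _ _ R3b; apply: R3E R3b.
have : filt kappa (tensor kappa Pi (tensor kappa Pi Pi)) R3.
  apply: (restr_filt hM hPPP); apply: (filt_tensor_dom hM hP hPP) => //.
  exact: (filt_tensor_dom hM hP hP).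
move=> /(filt_tensor hM); apply: QS => x /(filt_tensor hM); apply: QS => y.
by apply: QS => z /=; rewrite assocE.
Qed.

(** The assumption is stronger than [D] being implied by the square of [Pi], which
    asks it for generic [a] only. *)
Lemma tensor2_restr (D : set (ix (quot_prod P P) -> M)) :
  typedef C D -> @subset_on _ _ (quot_prod P P) D ->
  (forall a, R a -> Q [set b | D (join a b)]) ->
  restr C (P := quot_prod P P) (tensor kappa Pi Pi) `<=` D.
Proof.
move=> tD Don QD p [_ pR]; apply: pR => //.
have tDa : typedef C [set a | dom P a /\ Q [set b | D (join a b)]].
  apply: typedef_setI; first exact: (typedef_dom hP).
  apply: (typedef_generic hM hP PiP defPi sP tD) => b x y xy Dbx.
  apply: Don.2 (Dbx); split=> //=; apply: eqrefl.
  by have [] := Don.1 _ Dbx.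
apply: (tensor_entails hM sP sP) => //.
- apply: (typedef_stype hM) tD; exact: small_add.
- exact: (typedef_stype hM) tDa.
- by apply: QS QR => a Ra; split; [case: Ra|apply: QD].
Qed.

(** The operation of the chunk, restricted to the pairs at which [H] and [K] invert
    it.  This makes each translation injective and the translating element unique
    wherever it is defined, at the price of a smaller, but still generic, domain. *)
Definition chunk_op (a b c : ix P -> M) : Prop :=
  [/\ F (join a b) c, H (join a c) b & K (join b c) a].

Lemma tdrel_chunk_op : tdrel C chunk_op.
Proof.
have [_ tF _] := gc_F hchunk; have [_ tH _] := gc_H hchunk.
have [_ tK _] := gc_K hchunk.
have := tdrel_at (inl \o inl) (inl \o inr) inr (tdrel_graph tF).
move=> /(typedef_setI (typedef_setI
  (tdrel_at (inl \o inl) inr (inl \o inr) (tdrel_graph tH))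
  (tdrel_at (inl \o inr) inr (inl \o inl) (tdrel_graph tK)))).
by congr typedef; apply/seteqP; split=> c /= [] // [].
Qed.

Lemma partial_fun_inv (G : (ix (quot_prod P P) -> M) -> (ix P -> M) -> Prop)
    a b c a' b' c' :
  @partial_fun _ _ _ C (quot_prod P P) P G ->
  E a a' -> E b b' -> E c c' -> G (join a b) c -> G (join a' b') c'.
Proof.
move=> [[_ inv] _ _] aa' bb' cc' Gabc.
apply: (inv (join (join a b) c) (join (join a' b') c')); last by [].
by split=> //; split.
Qed.

Lemma partial_fun_dom (G : (ix (quot_prod P P) -> M) -> (ix P -> M) -> Prop) a b c :
  @partial_fun _ _ _ C (quot_prod P P) P G ->
  G (join a b) c -> [/\ E a a, E b b & E c c].
Proof.
move=> [[Gdom _] _ _] Gabc.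
have [[]] := Gdom (join (join a b) c) Gabc.
by move=> /eqrefl ? /eqrefl ? /eqrefl ?.
Qed.

Let FP := gc_F hchunk.

Lemma chunk_op_inv a b c a' b' c' : E a a' -> E b b' -> E c c' ->
  chunk_op a b c -> chunk_op a' b' c'.
Proof.
move=> aa' bb' cc' [Fabc Hacb Kbca]; split.
- exact: partial_fun_inv FP aa' bb' cc' Fabc.
- exact: partial_fun_inv (gc_H hchunk) aa' cc' bb' Hacb.
- exact: partial_fun_inv (gc_K hchunk) bb' cc' aa' Kbca.
Qed.

Lemma chunk_op_dom a b c : chunk_op a b c -> [/\ E a a, E b b & E c c].
Proof. by move=> [/(partial_fun_dom FP)]. Qed.

Lemma chunk_op_rel_on a : rel_on E (chunk_op a).
Proof.
split=> [x y x' y' axy xx' yy'|x y /chunk_op_dom[] //].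
by have [aa _ _] := chunk_op_dom axy; apply: chunk_op_inv axy.
Qed.

Lemma chunk_op_generic a : R a -> Q [set b | exists c, chunk_op a b c].
Proof.
move=> Ra; have := @restr_tensor2
  [set u : ix P + ix P -> M | exists c, chunk_op (u \o inl) (u \o inr) c].
by apply=> // u; rewrite -{1}[u]join_eta => /(gc_cancel hchunk).
Qed.

(** Inverse images are [Pi |- (F_a)_* Pi].  For a direct image [I], shrunk to a
    type-definable set, [I] is implied by [(F_a)_* Pi], hence by [Pi]. *)
Lemma chunk_op_pres a : R a -> preserving E Q (chunk_op a).
Proof.
move=> Ra; have [inv dom] := chunk_op_rel_on a; have [_ _ funF] := FP.
have eqdomr x y : eqv P x y -> @Defs.dom L M P y by move=> /eqdom[].
have QF : Q [set x | exists y, F (join a x) y].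
  by apply: QS (chunk_op_generic Ra) => x [y []]; exists y.
have funFa x y y' : F (join a x) y -> F (join a x) y' -> eqv P y y'.
  exact: funF.
split=> //.
- by move=> x y y' [Fxy _ _] [Fxy' _ _]; apply: funF Fxy Fxy'.
- have [_ _ funH] := gc_H hchunk.
  by move=> x x' y [_ Hxy _] [_ Hx'y _]; apply: funH Hxy Hx'y.
- move=> D /(filt_shrink hM eqdomr PiP)[D' [D'D QD' sD' [_ D'inv]]].
  pose I := [set y | exists x, D' x /\ chunk_op a x y].
  have sF : stype kappa [set c : ix P + ix P -> M | F (join a (c \o inl)) (c \o inr)].
    have [_ tF _] := FP; exact: (tdrel_stype hM sP a sP (tdrel_graph tF)).
  have s3 : stype kappa [set c : ix P + ix P -> M | chunk_op a (c \o inl) (c \o inr)].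
    exact: (tdrel_stype hM sP a sP tdrel_chunk_op).
  have sI : stype kappa I.
    apply: (stype_ex hM sP); apply: (stype_setI hM).
      exact: (stype_preim inr sD').
    exact: (stype_preim (join inr inl : _ -> ix P + ix P) s3).
  apply: (@QS I) => [y [x [/D'D ? ?]]|]; first by exists x.
  rewrite /Q -(gc_translate hchunk Ra).
  apply: (push_filt hM) => //.
  + split=> [y [x [_ /dom[_ /eqdom[]]]] //|y y' yy' [x [D'x axy]]].
    by exists x; split=> //; apply: inv (axy) _ yy'; have [] := dom _ _ axy.
  + apply: (stype_ex hM sP); apply: (stype_setI hM) => //.
    exact: (stype_preim inr sI).
  + apply: QS (QI QD' (chunk_op_generic Ra)) => x [D'x [y axy]].
    by exists y; split; [case: axy|exists x].
- move=> D /(filt_shrink hM eqdomr PiP)[D' [D'D QD' sD' [_ D'inv]]].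
  have : filt kappa (push kappa (P := P) (Q := P) (fun x y => F (join a x) y) Pi) D'.
    by rewrite (gc_translate hchunk Ra).
  move=> /(filt_push hM funFa QF) QD''.
  apply: QS (QI QD'' (chunk_op_generic Ra)) => x [[y [Fxy D'y]] [y' axy']].
  exists y'; split=> //; apply: D'D; apply: D'inv D'y.
  by apply: funFa Fxy _; case: axy'.
Qed.

(** Associativity of the chunk, read as [F_a F_b = F_(a b)] on germs. *)
Lemma chunk_op_mult a : R a -> Q (mult Q R chunk_op a).
Proof.
move=> Ra; have [_ _ funF] := FP.
have Qassoc : Q [set b | Q [set c | exists d e r, [/\ F (join b c) d,
    F (join a d) r, F (join a b) e & F (join e c) r]]].
  apply: (@restr_tensor3 [set u : ix P + (ix P + ix P) -> M | exists d e r,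
    [/\ F (join (u \o inr \o inl) (u \o inr \o inr)) d,
      F (join (u \o inl) d) r, F (join (u \o inl) (u \o inr \o inl)) e &
      F (join e (u \o inr \o inr)) r]]) Ra => u.
  rewrite -{1}[u]join_eta -{1}[u \o inr]join_eta => /(gc_assoc hchunk).
  by move=> [d [e [r ?]]]; exists d, e, r.
apply: QS (QI QR (QI (pres_preim (chunk_op_pres Ra) QR) Qassoc)).
move=> b [Rb [[c [Rc abc]] Qb]]; exists c; split=> //.
apply: QS (QI Qb (QI (chunk_op_generic Rc)
  (pres_preim (chunk_op_pres Rb) (chunk_op_generic Ra)))).
move=> x [[d [e [r [bxd adr abe exr]]]] [[r' cxr'] [d' [[r'' ad'r''] bxd']]]].
exists r''; split; first by exists d'.
have [aa bb cc] := chunk_op_dom abc.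
have [_ xx dd] := chunk_op_dom bxd'.
have [rr' _ _] := cxr'.
have [bxd'F _ _] := bxd'; have [ad'r''F _ _] := ad'r''; have [abcF _ _] := abc.
have [_ _ rr] := partial_fun_dom FP adr.
have r''r : E r'' r.
  apply: (funF _ _ _ ad'r''F); apply: (partial_fun_inv FP aa _ rr adr).
  exact: (funF _ _ _ bxd bxd'F).
have rr2 : E r r'.
  apply: (funF _ _ _ _ rr'); apply: (partial_fun_inv FP _ xx rr exr).
  exact: (funF _ _ _ abe abcF).
by apply: chunk_op_inv cxr' => //; apply: eqsym; apply: eqtrans r''r rr2.
Qed.

Lemma chunk_op_cancel a b x y : chunk_op a x y -> chunk_op b x y -> E a b.
Proof.
by have [_ _ funK] := gc_K hchunk => -[_ _ axy] [_ _ bxy]; apply: funK axy bxy.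
Qed.

End Translations.

(** * The group of fractions *)

Section FractionGroup.
Variables (L : language) (T : set (sentence L)) (kappa : Type) (M : structure L).
Hypothesis hM : monster M T kappa.
Variables (C : heqset kappa M) (P : quot M).
Hypothesis hP : hyperdefinable C P.
Variables (Pi : set (pformula M (ix P)))
  (F H K : (ix (quot_prod P P) -> M) -> (ix P -> M) -> Prop).
Hypothesis hchunk : group_chunk C Pi F H K.
Hypothesis consistent : ~ filt kappa Pi set0.

Let small_add := small_sum (monster_uncountable hM) (monster_regular hM).
Let sP := hyperdefinable_small hP.
Let eqdom := hyperdefinable_dom hP.
Let eqsym := hyperdefinable_sym hP.
Let eqtrans := hyperdefinable_trans hP.
Let PiP := gc_type hchunk.
Let defPi := gc_def hchunk.
Let E := eqv P.
Let Q := filt kappa Pi.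
Let R := restr C Pi.
Let F3 := chunk_op F H K.
Let QS := @filtS L kappa M (ix P) Pi.
Let QI := @filt_setI L T kappa M hM (ix P) Pi.
Let QR : Q R := filt_restr hM hP PiP.
Let QE : Q [set x | E x x] := filt_eqv_refl hM hP hchunk.
Let Rinv : forall a b, E a b -> R a -> R b := restr_inv hP (Pi := Pi).
Let Fpres : forall a, R a -> preserving E Q (F3 a) := chunk_op_pres hM hP hchunk.
Let Fmult : forall a, R a -> Q (mult Q R F3 a) := chunk_op_mult hM hP hchunk.

Lemma filt_nonempty (D : set (ix P -> M)) : Q D -> D !=set0.
Proof. by move=> QD; apply/set0P/eqP => D0; apply: consistent; rewrite -D0. Qed.

Lemma F3_inv a b x y : E a b -> F3 a x y -> F3 b x y.
Proof.
move=> ab axy; have [_ xx yy] := chunk_op_dom hP hchunk axy.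
exact: (chunk_op_inv hchunk ab xx yy axy).
Qed.

Let Qtrans := germ_trans QS QI (E := E).
Let Qcomp := germ_rcomp QS QI (E := E).
Let Qsym := @germ_sym _ _ QS.

(** The pair [(a, b)] codes the germ of [F_a F_b^-1]. *)
Definition grp (g : ix P + ix P -> M) : Prop := R (g \o inl) /\ R (g \o inr).

Definition grp_germ (g : ix P + ix P -> M) := frac F3 (g \o inl) (g \o inr).

Definition grp_quot : quot M :=
  @Quot L M (ix P + ix P) grp
    (fun g h => grp g /\ grp h /\ germ_eq Q (grp_germ g) (grp_germ h)).

Definition grp_mul (p : ix (quot_prod grp_quot grp_quot) -> M)
    (k : ix grp_quot -> M) : Prop :=
  grp (p \o inl) /\ grp (p \o inr) /\ grp k /\
  germ_eq Q (rcomp (grp_germ (p \o inl)) (grp_germ (p \o inr))) (grp_germ k).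

Definition grp_embed (a : ix P -> M) (k : ix grp_quot -> M) : Prop :=
  R a /\ grp k /\ germ_eq Q (F3 a) (grp_germ k).

Lemma pres_grp_germ g : grp g -> preserving E Q (grp_germ g).
Proof. by move=> [Ra Rb]; apply: (pres_frac QS Fpres). Qed.

Lemma pres_grp_germ_mul g h : grp g -> grp h ->
  preserving E Q (rcomp (grp_germ g) (grp_germ h)).
Proof. by move=> gg gh; apply: (pres_rcomp QS); apply: pres_grp_germ. Qed.

Lemma grp_germ_on g : rel_on E (grp_germ g).
Proof.
by apply: rel_on_rcomp; [|apply: rel_on_rinv]; apply: (chunk_op_rel_on hP hchunk).
Qed.

Lemma tdrel_grp_germ : tdrel C grp_germ.
Proof.
apply: (tdrel_rcomp hM sP (small_add sP sP)).
  exact: tdrel_reindex (tdrel_chunk_op hchunk).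
apply: tdrel_rinv; exact: tdrel_reindex (tdrel_chunk_op hchunk).
Qed.

Lemma typedef_grp : typedef C grp.
Proof.
by apply: typedef_setI; apply: typedef_preim; apply: restr_typedef.
Qed.

Let sPP : small kappa [set: ix P + ix P] := small_add sP sP.

Lemma grp_hyperdefinable : hyperdefinable C grp_quot.
Proof.
split=> //; split.
  by have [a Ra] := filt_nonempty QR; exists (join a a).
split; first exact: typedef_grp.
split.
  apply: typedef_setI; first exact/typedef_preim/typedef_grp.
  apply: typedef_setI; first exact/typedef_preim/typedef_grp.
  apply: (typedef_germ_eq hM sP defPi eqdom).
  - exact: small_add.
  - exact: tdrel_reindex tdrel_grp_germ.
  - exact: tdrel_reindex tdrel_grp_germ.
  - by move=> c; apply: grp_germ_on.
  - by move=> c; apply: grp_germ_on.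
split; first by move=> g h [? []].
split.
  by move=> g gg; do 2 split=> //; apply: (germ_refl QS QE (pres_grp_germ gg)).
split; first by move=> g h [gg [gh gE]]; split=> //; split=> //; apply: Qsym.
move=> g h k [gg [gh gE]] [_ [gk hE]]; split=> //; split=> //.
exact: Qtrans (pres_grp_germ gh) (pres_grp_germ gk) gE hE.
Qed.

Lemma grp_mul_fun :
  @partial_fun _ _ _ C (quot_prod grp_quot grp_quot) grp_quot grp_mul.
Proof.
split; [split| |].
- by move=> c [? [? []]].
- move=> c d [[[_ [gd1 g1]] [_ [gd2 g2]]] [_ [gd3 g3]]] [gc1 [gc2 [gc3 gc]]].
  split=> //; split=> //; split=> //.
  apply: (Qtrans _ _ _ g3); [exact: pres_grp_germ|exact: pres_grp_germ|].
  apply: (Qtrans _ _ _ gc); [exact: pres_grp_germ_mul|exact: pres_grp_germ|].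
  by apply: Qcomp; rewrite ?pres_grp_germ; try exact: Qsym; apply: pres_grp_germ.
- apply: typedef_setI.
    exact: (typedef_preim (inl \o inl) typedef_grp).
  apply: typedef_setI.
    exact: (typedef_preim (inl \o inr) typedef_grp).
  apply: typedef_setI; first exact: (typedef_preim inr typedef_grp).
  apply: (typedef_germ_eq hM sP defPi eqdom).
  + exact/small_add/sPP/small_add.
  + apply: (tdrel_rcomp hM sP); first exact/small_add/sPP/small_add.
      exact: (tdrel_reindex (inl \o inl) tdrel_grp_germ).
    exact: (tdrel_reindex (inl \o inr) tdrel_grp_germ).
  + exact: (tdrel_reindex inr tdrel_grp_germ).
  + by move=> c; apply: rel_on_rcomp; apply: grp_germ_on.
  + by move=> c; apply: grp_germ_on.
- move=> p k k' [gp1 [gp2 [gk E1]]] [_ [_ [gk' E2]]]; split=> //; split=> //.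
  by apply: Qtrans (Qsym E1) E2; [apply: pres_grp_germ_mul|apply: pres_grp_germ].
Qed.

(** Products of fractions are fractions, so pairs suffice to code the group. *)
Lemma grp_mul_total g h : grp g -> grp h -> exists k, grp_mul (join g h) k.
Proof.
move=> gg gh.
have [p [q [Rp Rq pqE]]] := frac_mul eqsym eqtrans QS QI QE filt_nonempty Rinv
  Fpres F3_inv Fmult gg.1 gg.2 gh.1 gh.2.
by exists (join p q).
Qed.

(** The pair [(a, a)] codes the unit, and [(b, a)] the inverse of [(a, b)]. *)
Lemma grp_mul_unit_inv : exists e : ix grp_quot -> M, grp e /\ forall g, grp g ->
  [/\ grp_mul (join e g) g, grp_mul (join g e) g &
      exists h, grp_mul (join g h) e /\ grp_mul (join h g) e].
Proof.
have [a Ra] := filt_nonempty QR; exists (join a a).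
have ge : grp (join a a) by [].
have eE : germ_eq Q (grp_germ (join a a)) E by apply: (frac_id QS QE Fpres).
have pE := pres_E eqsym eqtrans QS QI QE.
split=> // g gg; have pg := pres_grp_germ gg.
have refl := germ_refl QS QE pg.
split.
- split=> //; split=> //; split=> //.
  rewrite -[X in germ_eq _ _ X](rcompEl pg).
  by apply: Qcomp => //; apply: pres_grp_germ.
- split=> //; split=> //; split=> //.
  rewrite -[X in germ_eq _ _ X](rcompE eqsym pg).
  by apply: Qcomp => //; apply: pres_grp_germ.
- exists (join (g \o inr) (g \o inl)).
  have gh : grp (join (g \o inr) (g \o inl)) by case: gg.
  have hE : grp_germ (join (g \o inr) (g \o inl)) = rinv (grp_germ g).
    by rewrite /grp_germ frac_rinv.
  split; split=> //; split=> //; split=> //=.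
  + apply: (Qtrans pE _ _ (Qsym eE)); first exact: pres_grp_germ.
    by rewrite hE; apply: (germ_rinvK QS QE).
  + apply: (Qtrans pE _ _ (Qsym eE)); first exact: pres_grp_germ.
    by rewrite hE; apply: (germ_rinvKl QS QE).
Qed.

Lemma grp_group : hyperdef_group C grp_mul.
Proof.
split.
- exact: grp_hyperdefinable.
- exact: grp_mul_fun.
- exact: grp_mul_total.
- move=> u v w p q r [gu [gv [gp uvp]]] [_ [gw [gr pwr]]] [_ [_ [gq vwq]]].
  split=> //; split=> //; split=> //=.
  apply: (Qtrans _ _ _ pwr); [exact: pres_grp_germ_mul|exact: pres_grp_germ|].
  apply: (@Qtrans (rcomp (rcomp (grp_germ u) (grp_germ v)) (grp_germ w))).
  + by apply: (pres_rcomp QS); [apply: pres_grp_germ_mul|apply: pres_grp_germ].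
  + exact: pres_grp_germ_mul.
  + rewrite -rcompA; apply: Qcomp; try exact: pres_grp_germ.
      exact: (germ_refl QS QE (pres_grp_germ gu)).
    exact: Qsym.
  + apply: Qcomp => //; try exact: pres_grp_germ.
      exact: pres_grp_germ_mul.
    exact: (germ_refl QS QE (pres_grp_germ gw)).
- exact: grp_mul_unit_inv.
Qed.

Lemma grp_embed_fun : @partial_fun _ _ _ C P grp_quot grp_embed.
Proof.
split; [split| |].
- by move=> c [[ad _] [gk _]].
- move=> c d [cd [_ [gd cdE]]] [Ra [gk cE]]; split; first exact: Rinv cd Ra.
  split=> //; rewrite -(F_eq eqsym F3_inv cd).
  by apply: Qtrans cE cdE; apply: pres_grp_germ.
- apply: typedef_setI; first exact/typedef_preim/(restr_typedef hP).
  apply: typedef_setI; first exact/typedef_preim/typedef_grp.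
  apply: (typedef_germ_eq hM sP defPi eqdom).
  + exact: small_add.
  + exact: tdrel_reindex (tdrel_chunk_op hchunk).
  + exact: tdrel_reindex tdrel_grp_germ.
  + by move=> c; apply: (chunk_op_rel_on hP hchunk).
  + by move=> c; apply: grp_germ_on.
- move=> a k k' [Ra [gk E1]] [_ [gk' E2]]; split=> //; split=> //.
  by apply: Qtrans (Qsym E1) E2; [apply: Fpres|apply: pres_grp_germ].
Qed.

Lemma grp_embed_total a : R a -> exists k, grp_embed a k.
Proof.
move=> Ra.
have [p [q [Rp Rq pqE]]] :=
  F_frac eqsym eqtrans QS QI QE filt_nonempty Fpres Fmult Ra.
by exists (join p q).
Qed.

(** Translations with the same germ agree at some point, where [K] recovers the
    translating element. *)
Lemma grp_embed_inj a a' k : grp_embed a k -> grp_embed a' k -> E a a'.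
Proof.
move=> [Ra [gk E1]] [Ra' [_ E2]].
apply: (F_germ_inj filt_nonempty (chunk_op_cancel hchunk) Ra Ra').
by apply: Qtrans E1 (Qsym E2); [apply: pres_grp_germ|apply: Fpres].
Qed.

Lemma grp_embed_mul a b c u v w : R c ->
  germ_eq Q (rcomp (F3 a) (F3 b)) (F3 c) ->
  grp_embed a u -> grp_embed b v -> grp_embed c w -> grp_mul (join u v) w.
Proof.
move=> Rc abc [Ra [gu au]] [Rb [gv bv]] [_ [gw cw]].
split=> //; split=> //; split=> //=.
apply: (Qtrans _ _ _ cw); [exact: Fpres|exact: pres_grp_germ|].
apply: (Qtrans _ _ _ abc); [|exact: Fpres|].
  by apply: (pres_rcomp QS); apply: Fpres.
by apply: Qcomp; try exact: Qsym; try exact: pres_grp_germ; apply: Fpres.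
Qed.

(** The conclusion holds generically over every realization of [Pi|_C]; being
    [C]-type-definable, it holds on the restriction of the square of [Pi]. *)
Lemma grp_embed_tensor a b :
  restr C (P := quot_prod P P) (tensor kappa Pi Pi) (join a b) ->
  exists c u v w, F (join a b) c /\ grp_embed a u /\ grp_embed b v /\
    grp_embed c w /\ grp_mul (join u v) w.
Proof.
move=> abR.
pose D : set (ix P + ix P -> M) := [set u : ix P + ix P -> M | exists c,
  (R (u \o inl) /\ R (u \o inr)) /\
  R c /\ F3 (u \o inl) (u \o inr) c /\
  germ_eq Q (rcomp (F3 (u \o inl)) (F3 (u \o inr))) (F3 c)].
have tF3 := tdrel_chunk_op hchunk; have tR := restr_typedef hP Pi.
have tD : typedef C D.
  apply: (typedef_ex hM sPP sP).
  apply: typedef_setI; first exact: (typedef_preim inl typedef_grp).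
  apply: typedef_setI; first exact: (typedef_preim inr tR).
  apply: typedef_setI.
    exact: (tdrel_at (inl \o inl) (inl \o inr) inr tF3).
  apply: (typedef_germ_eq hM sP defPi eqdom).
  - exact: small_add.
  - apply: (tdrel_rcomp hM sP); first exact: small_add.
      exact: (tdrel_reindex (inl \o inl) tF3).
    exact: (tdrel_reindex (inl \o inr) tF3).
  - exact: (tdrel_reindex inr tF3).
  - by move=> c; apply: rel_on_rcomp; apply: (chunk_op_rel_on hP hchunk).
  - by move=> c; apply: (chunk_op_rel_on hP hchunk).
have Don : @subset_on _ _ (quot_prod P P) D.
  split=> [u [c [[[ad _] [bd _]] _]] //|u v [uv1 uv2] [c [[Ra Rb] [Rc [abc gE]]]]].
  exists c; split; first by split; [apply: Rinv uv1 Ra|apply: Rinv uv2 Rb].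
  split=> //; rewrite -(F_eq eqsym F3_inv uv1) -(F_eq eqsym F3_inv uv2); split=> //.
  have [aa bb cc] := chunk_op_dom hP hchunk abc.
  exact: (chunk_op_inv hchunk aa uv2 cc abc).
have : D (join a b).
  apply: (tensor2_restr hM hP hchunk tD Don) abR => x Rx.
  apply: QS (Fmult Rx) => y [z [xyz Ry Rz g]]; exists z; split=> //.
move=> [c [[Ra Rb] [Rc [abc gE]]]].
have [u au] := grp_embed_total Ra; have [v bv] := grp_embed_total Rb.
have [w cw] := grp_embed_total Rc.
exists c, u, v, w; split; first by case: abc.
by do 3 split=> //; apply: (grp_embed_mul Rc gE).
Qed.

Lemma stype_grp_embed :
  stype kappa [set c : ix P + (ix P + ix P) -> M | grp_embed (c \o inl) (c \o inr)].
Proof.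
have [_ tf _] := grp_embed_fun; apply: (typedef_stype hM) tf.
exact: small_add.
Qed.

Lemma stype_grp_mul g :
  stype kappa [set c : (ix P + ix P) + (ix P + ix P) -> M |
    grp_mul (join g (c \o inl)) (c \o inr)].
Proof.
have [_ tm _] := grp_mul_fun.
have /(typedef_stype hM)/(_ tm) :
    small kappa [set: ix (quot_prod grp_quot grp_quot) + ix grp_quot].
  by do 2 ?apply: small_add.
move=> /(stype_subst (fun u => match u with
  | inl (inl i) => inr (g i)
  | inl (inr j) => inl (inl j)
  | inr k => inl (inr k) end)).
congr stype; apply/seteqP; split=> c; rewrite /rel_set /=;
  congr grp_mul; by apply: funext => -[].
Qed.

Lemma grp_embed_defined : defined_on kappa grp_embed Pi.
Proof.
apply/(entails_setP hM) => //; split.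
  by apply: (stype_ex hM sPP); apply: stype_grp_embed.
by apply: QS QR => a /grp_embed_total.
Qed.

Lemma push_embed_filt (D : set (ix grp_quot -> M)) : stype kappa D -> subset_on D ->
  filt kappa (push kappa grp_embed Pi) D <->
  Q [set a | exists k, grp_embed a k /\ D k].
Proof.
move=> sD Don; split.
  apply: (filt_push hM); first by have [] := grp_embed_fun.
  by apply: QS QR => a /grp_embed_total.
apply: (push_filt hM) => //.
apply: (stype_ex hM sPP); apply: (stype_setI hM); first exact: stype_grp_embed.
exact: (stype_preim inr sD).
Qed.

Lemma push_embed_grp : entails_set kappa (push kappa grp_embed Pi) (dom grp_quot).
Proof.
have sgrp : stype kappa grp by apply: (typedef_stype hM) typedef_grp.
apply/(entails_setP hM) => //; split=> //.
apply/push_embed_filt => //.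
  by split=> [g //|g h [_ []]].
apply: QS QR => a /grp_embed_total[k ak]; exists k; split=> //.
by case: ak => _ [].
Qed.

(** Both sides say that [k] codes the germ [g F_a = F_a']. *)
Lemma grp_embed_translate g a a' h k : grp g -> R a' ->
  germ_eq Q (F3 a') (rcomp (grp_germ g) (F3 a)) -> grp_embed a h ->
  grp_mul (join g h) k <-> grp_embed a' k.
Proof.
move=> gg Ra' E' [Ra [gh ah]]; have pgh := pres_grp_germ_mul gg gh.
have E'' : germ_eq Q (F3 a') (rcomp (grp_germ g) (grp_germ h)).
  apply: Qtrans E' _ => //.
    by apply: (pres_rcomp QS); [exact: pres_grp_germ|exact: Fpres].
  apply: Qcomp => //; try exact: pres_grp_germ; try exact: Fpres.
  exact: (germ_refl QS QE (pres_grp_germ gg)).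
split=> [[_ [_ [gk ghk]]]|[_ [gk a'k]]].
  by split=> //; split=> //; apply: Qtrans E'' ghk => //; apply: pres_grp_germ.
split=> //; split=> //; split=> //=.
by apply: Qtrans (Qsym E'') a'k; [apply: Fpres|apply: pres_grp_germ].
Qed.

(** Translating by [g] in the group corresponds to moving [a] by the fraction [g] on
    [P], and the latter preserves the filter. *)
Lemma push_embed_translate g (D : set (ix grp_quot -> M)) : grp g ->
  Q [set a | exists h, grp_embed a h /\ exists k, grp_mul (join g h) k /\ D k] <->
  Q [set a | exists k, grp_embed a k /\ D k].
Proof.
move=> gg; have pg := pres_grp_germ gg.
have QT := frac_equivariant eqsym eqtrans QS QI QE Rinv Fpres F3_inv Fmult gg.1 gg.2.
have moveE a a' k : E a a' -> grp_embed a k -> grp_embed a' k.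
  move=> aa' [Ra ak]; rewrite /grp_embed -(F_eq eqsym F3_inv aa').
  by split=> //; apply: Rinv aa' Ra.
split=> [QD|QD].
  apply: QS (pres_image pg (QI QD QT)) => y [a [[[h [ah [k [ghk Dk]]]]]]].
  move=> [a' [aa' Ra Ra' gE]] ay; exists k; split=> //.
  apply: (moveE a'); first exact: (pres_fun pg aa' ay).
  exact/(grp_embed_translate k gg Ra' gE ah).
apply: QS (QI (pres_preim pg QD) QT) => a [[y [[k [yk Dk]] ay]]].
move=> [a' [aa' Ra Ra' gE]].
have [h ah] := grp_embed_total Ra; exists h; split=> //; exists k; split=> //.
apply/(grp_embed_translate k gg Ra' gE ah); apply: (moveE y) yk.
exact: (pres_fun pg ay aa').
Qed.

Lemma push_embed_invariant : left_invariant kappa grp_mul (push kappa grp_embed Pi).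
Proof.
move=> g gg.
have [[_ mul_inv] _ _] := grp_mul_fun.
have key Gam : small_type_on kappa (P := grp_quot) Gam ->
    entails_set kappa (push kappa grp_embed Pi)
      [set h | exists k, grp_mul (join g h) k /\ realizations Gam k] <->
    entails_set kappa Pi [set a | exists k, grp_embed a k /\ realizations Gam k].
  move=> [sG Gon]; set D := realizations Gam in Gon *.
  have sD : stype kappa D by exists Gam.
  have sX : stype kappa [set h | exists k, grp_mul (join g h) k /\ D k].
    apply: (stype_ex hM sPP); apply: (stype_setI hM); first exact: stype_grp_mul.
    exact: (stype_preim inr sD).
  have sY : stype kappa [set a | exists k, grp_embed a k /\ D k].
    apply: (stype_ex hM sPP); apply: (stype_setI hM); first exact: stype_grp_embed.
    exact: (stype_preim inr sD).
  have Xon : @subset_on _ _ grp_quot [set h | exists k, grp_mul (join g h) k /\ D k].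
    split=> [h [k [[_ [? _]] _]] //|h h' hh' [k [ghk Dk]]]; exists k; split=> //.
    apply: (mul_inv (join (join g h) k) (join (join g h') k)) (ghk).
    have [_ [_ [gk _]]] := ghk.
    have refl u : grp u -> eqv grp_quot u u.
      by move=> gu; split=> //; split=> //; apply: (germ_refl QS QE (pres_grp_germ gu)).
    by split; [split=> //; exact: refl|exact: refl].
  have X := push_embed_translate D gg; have Y := push_embed_filt sX Xon.
  split=> /(entails_setP hM)[] // _ h; apply/(entails_setP hM) => //; split=> //.
    exact/X/Y.
  exact/Y/X.
by apply/seteqP; split=> phi [Gam [Gon eG Gphi]]; exists Gam; split=> //;
  apply/key.
Qed.

End FractionGroup.

(** When [Pi] is inconsistent there are no realizations of [Pi|_C] to code the group
    by, and every set is in its filter; the trivial group will do. *)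
Section TrivialGroup.
Variables (L : language) (T : set (sentence L)) (kappa : Type) (M : structure L).
Hypothesis hM : monster M T kappa.
Variables (C : heqset kappa M) (P : quot M).
Hypothesis hP : hyperdefinable C P.

Let sP := hyperdefinable_small hP.
Let small_add := small_sum (monster_uncountable hM) (monster_regular hM).

Definition trivial_quot : quot M :=
  @Quot L M (ix P) (dom P) (fun a b => dom P a /\ dom P b).

Definition trivial_mul (p : ix (quot_prod trivial_quot trivial_quot) -> M)
    (k : ix trivial_quot -> M) : Prop :=
  dom P (p \o inl) /\ dom P (p \o inr) /\ dom P k.

Definition trivial_map (a : ix P -> M) (k : ix trivial_quot -> M) : Prop :=
  dom P a /\ dom P k.

Lemma trivial_group : hyperdef_group C trivial_mul.
Proof.
have tP := typedef_dom hP; have [_ [[e eP] _]] := hP.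
split.
- split=> //; split; first by exists e.
  split=> //; split; first by apply: typedef_setI; apply: typedef_preim.
  by split=> [a b []|] //; split=> [a //|]; split=> [a b []|a b c [? ?] [? ?]].
- split; [split| |by move=> p k k' [_ [_ ?]] [_ [_ ?]]].
  + by move=> c [? [? ?]].
  + by move=> c d [[[_ ?] [_ ?]] [_ ?]] _.
  apply: typedef_setI; first exact: (typedef_preim (inl \o inl) tP).
  apply: typedef_setI; first exact: (typedef_preim (inl \o inr) tP).
  exact: (typedef_preim inr tP).
- by move=> u v uP vP; exists e.
- by move=> u v w p q r [? [? ?]] [? [? ?]] [? [? ?]].
- by exists e; split=> // u uP; split=> //; exists e.
Qed.

Lemma trivial_map_fun : @partial_fun _ _ _ C P trivial_quot trivial_map.
Proof.
have tP := typedef_dom hP.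
split; [split=> [c [? ?] //|c d [cd [_ ?]] [? ?]]| |by move=> a k k' [_ ?] [_ ?]].
  by split=> //; have [] := hyperdefinable_dom hP cd.
by apply: typedef_setI; apply: typedef_preim.
Qed.

Variables (Pi : set (pformula M (ix P)))
  (F H K : (ix (quot_prod P P) -> M) -> (ix P -> M) -> Prop).
Hypothesis hchunk : group_chunk C Pi F H K.
Hypothesis inconsistent : filt kappa Pi set0.

Lemma typedef_set0 (I : Type) : typedef C (set0 : set (I -> M)).
Proof.
apply: typedef_of0; exists [set Bot]; apply/seteqP; split=> a; first by [].
by move/(_ Bot erefl).
Qed.

Lemma restr_inconsistent a : ~ restr C Pi a.
Proof.
by move=> /(restr_min hM hP (gc_type hchunk) (@typedef_set0 _)); apply.
Qed.

Lemma restr_tensor_inconsistent p :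
  ~ restr C (P := quot_prod P P) (tensor kappa Pi Pi) p.
Proof.
move=> /(tensor2_restr hM hP hchunk (@typedef_set0 _)); by apply.
Qed.

Lemma stype_dom : stype kappa (dom P).
Proof. exact: (typedef_stype hM sP (typedef_dom hP)). Qed.

Lemma stype_trivial_map (D : set (ix P -> M)) : stype kappa D ->
  stype kappa [set a | exists k, trivial_map a k /\ D k].
Proof.
move=> sD; apply: (stype_ex hM sP); apply: (stype_setI hM).
  by apply: (stype_setI hM); apply: stype_preim; apply: stype_dom.
exact: (stype_preim inr sD).
Qed.

Lemma trivial_push_inconsistent :
  filt kappa (push kappa (Q := trivial_quot) trivial_map Pi) set0.
Proof.
have s0 : stype kappa (set0 : set (ix P -> M)).
  by apply: (typedef_stype hM sP); apply: typedef_set0.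
apply: (push_filt hM) => //; last exact: filtS inconsistent.
  by split.
exact: (stype_trivial_map s0).
Qed.

Lemma trivial_left_invariant :
  left_invariant kappa trivial_mul (push kappa (Q := trivial_quot) trivial_map Pi).
Proof.
move=> g gP.
have mulE D : [set h | exists k, trivial_mul (join g h) k /\ D k] =
    [set h | exists k, trivial_map h k /\ D k].
  apply/seteqP; split=> h [k [hk Dk]]; by exists k; split=> //; case: hk.
have key Gam : small_type_on kappa (P := trivial_quot) Gam ->
    entails_set kappa (push kappa (Q := trivial_quot) trivial_map Pi)
      [set h | exists k, trivial_mul (join g h) k /\ realizations Gam k] /\
    entails_set kappa Pi [set a | exists k, trivial_map a k /\ realizations Gam k].
  move=> [sG _].
  have sX := stype_trivial_map (D := realizations Gam) (ex_intro2 _ _ _ sG erefl).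
  rewrite mulE; split; apply/(entails_setP hM) => //; split=> //.
    by apply: filtS trivial_push_inconsistent.
  by apply: filtS inconsistent.
by apply/seteqP; split=> phi [Gam [Gon _ Gphi]]; exists Gam; split=> //;
  case: (key Gam Gon).
Qed.

End TrivialGroup.

(** * The group chunk theorem *)

Theorem theorem4p18 (L : language) (T : set (sentence L)) (kappa : Type)
    (M : structure L) (hT : complete_theory T) (hM : monster M T kappa)
    (C : heqset kappa M) (P : quot M) (hP : hyperdefinable C P)
    (Pi : set (pformula M (ix P)))
    (F H K : (ix (quot_prod P P) -> M) -> (ix P -> M) -> Prop)
    (hchunk : group_chunk C Pi F H K) :
  exists (G : quot M)
         (mul : (ix (quot_prod G G) -> M) -> (ix G -> M) -> Prop)
         (f : (ix P -> M) -> (ix G -> M) -> Prop),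
    hyperdef_group C mul /\
    partial_fun C f /\
    defined_on kappa f Pi /\
    (forall a a' u, restr C Pi a -> restr C Pi a' ->
       f a u -> f a' u -> eqv P a a') /\
    (forall a b : ix P -> M,
       restr C (P := quot_prod P P) (tensor kappa Pi Pi) (join a b) ->
       exists c u v w,
         F (join a b) c /\ f a u /\ f b v /\ f c w /\ mul (join u v) w) /\
    entails_set kappa (push kappa f Pi) (dom G) /\
    left_invariant kappa mul (push kappa f Pi).
Proof.
have [inconsistent|consistent] := pselect (filt kappa Pi set0).
  exists (trivial_quot P), (@trivial_mul L M P), (@trivial_map L M P).
  split; first exact: trivial_group.
  split; first exact: trivial_map_fun.
  have sP := hyperdefinable_small hP; have sdom := stype_dom hM hP.
  split.
    apply/(entails_setP hM) => //; split; last exact: filtS inconsistent.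
    apply: (stype_ex hM sP).
    by apply: (stype_setI hM); apply: stype_preim.
  split; first by move=> a a' u /(restr_inconsistent hM hP hchunk inconsistent).
  split; first by move=> a b /(restr_tensor_inconsistent hM hP hchunk inconsistent).
  split; last exact: (trivial_left_invariant hM hP inconsistent).
  apply/(entails_setP hM) => //; split=> //.
  exact: filtS (trivial_push_inconsistent hM hP inconsistent).
exists (grp_quot C Pi F H K), (@grp_mul L kappa M C P Pi F H K),
  (@grp_embed L kappa M C P Pi F H K).
split; first exact: (grp_group hM hP hchunk consistent).
split; first exact: (grp_embed_fun hM hP hchunk).
split; first exact: (grp_embed_defined hM hP hchunk consistent).
split; first by move=> a a' u _ _; apply: (grp_embed_inj hM hP hchunk consistent).
split; first exact: (grp_embed_tensor hM hP hchunk consistent).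
split; first exact: (push_embed_grp hM hP hchunk consistent).
exact: (push_embed_invariant hM hP hchunk consistent).
Qed.
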